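(* Let $(A,\mathfrak m)$ be a catenary noetherian local ring such that the set $\{\mathfrak p\in\operatorname{Spec}A: A_{\mathfrak p}\text{ is not Cohen–Macaulay}\}$ is finite. Then for every finite $A$-module $M$, the Cohen–Macaulay locus $\operatorname{CM}(M)$ is an open subset of $\operatorname{Spec}A$.
   Context: ''Finite module'' means finitely generated. $\operatorname{CM}(M)=\{\mathfrak p\in\operatorname{Spec}A: M_{\mathfrak p}\text{ is a Cohen–Macaulay }A_{\mathfrak p}\text{-module}\}$, where the zero module counts as Cohen–Macaulay. Open means open in the Zariski topology. *)

(* Defs.v *)
From HB Require Import structures.
From mathcomp Require Import all_boot all_order all_algebra.
From mathcomp Require Import all_classical topology.
From mathcomp Require Import ring.

Set Implicit Arguments.
Unset Strict Implicit.
Unset Printing Implicit Defensive.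

Import GRing.Theory.
Local Open Scope quotient_scope.
Local Open Scope classical_set_scope.
Local Open Scope ring_scope.

(* [idealr_closed] only admits proper ideals. *)
Definition prime_ideal (A : comNzRingType) (p : set A) : Prop :=
  idealr_closed [in p] /\ prime_idealr_closed [in p].

Definition maximal_ideal (A : comNzRingType) (m : set A) : Prop :=
  idealr_closed [in m] /\
  forall I : set A, idealr_closed [in I] -> m `<=` I -> I = m.

Definition local_ring (A : comNzRingType) (m : set A) : Prop :=
  maximal_ideal m /\ forall n : set A, maximal_ideal n -> n = m.

Record Spec (A : comNzRingType) : Type := MkSpec {
  spec_set :> set A;
  spec_prime : prime_ideal spec_set }.

HB.instance Definition _ (A : comNzRingType) := gen_eqMixin (Spec A).
HB.instance Definition _ (A : comNzRingType) := gen_choiceMixin (Spec A).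

Section SpecTheory.
Variables (A : comNzRingType) (p : Spec A).

Lemma spec0 : 0 \in spec_set p.
Proof. by have [[]] := spec_prime p. Qed.

Lemma spec1 : 1 \notin spec_set p.
Proof. by have [[]] := spec_prime p. Qed.

Lemma specMD a x y :
  x \in spec_set p -> y \in spec_set p -> a * x + y \in spec_set p.
Proof. by have [[_ _ h] _] := spec_prime p; exact: h. Qed.

Lemma specMr a x : x \in spec_set p -> a * x \in spec_set p.
Proof. by move=> px; rewrite -[_ * _]addr0 specMD ?spec0. Qed.

Lemma specM x y :
  (x * y \in spec_set p) = (x \in spec_set p) || (y \in spec_set p).
Proof.
apply/idP/idP; first by have [_] := spec_prime p; apply.
by case/orP => [|/specMr//]; rewrite mulrC; apply: specMr.
Qed.

End SpecTheory.

Lemma spec_eq (A : comNzRingType) (p q : Spec A) :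
  spec_set p = spec_set q -> p = q.
Proof.
case: p q => p pP [q qP] /= pq; rewrite -pq in qP *.
by congr MkSpec; apply: Prop_irrelevance.
Qed.

Definition zariski_open (A : comNzRingType) (U : set (Spec A)) : Prop :=
  exists E : set A, U = ~` [set p : Spec A | E `<=` p].

Section Zariski.
Variable A : comNzRingType.

Lemma zariski_openT : zariski_open (@setT (Spec A)).
Proof.
exists setT; apply/seteqP; split=> // p _ /= /(_ 1 Logic.I) p1.
by have := spec1 p; rewrite notin_setE.
Qed.

Lemma zariski_openI : setI_closed (@zariski_open A).
Proof.
move=> _ _ [E ->] [F ->]; exists [set a * b | a in E & b in F].
apply/seteqP; split=> p /=.
  move=> [/existsNP[a /not_implyP[Ea pa]] /existsNP[b /not_implyP[Fb pb]]] EF.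
  have := EF (a * b); move=> /(_ (ex_intro2 _ _ a Ea (ex_intro2 _ _ b Fb erefl))) /mem_set.
  by rewrite specM => /orP[]; rewrite in_setE.
move=> /existsNP[_ /not_implyP[[a Ea [b Fb <-]]]] pab.
split=> [/(_ a Ea)|/(_ b Fb)] pp; apply: pab; apply/set_mem;
  by rewrite specM (mem_set pp) ?orbT.
Qed.

Lemma zariski_open_bigcup (I : Type) (f : I -> set (Spec A)) :
  (forall i, zariski_open (f i)) -> zariski_open (\bigcup_i f i).
Proof.
move=> /choice[E fE]; exists (\bigcup_i E i); apply/seteqP; split=> p /=.
  by move=> [i _]; rewrite fE => Eip EEp; apply: Eip => a Ea; apply: EEp; exists i.
move=> /existsNP[a /not_implyP[[i _ Ea] pa]].
by exists i => //; rewrite fE => /(_ a Ea).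
Qed.

HB.instance Definition _ := @isOpenTopological.Build (Spec A)
  (@zariski_open A) zariski_openT zariski_openI zariski_open_bigcup.

End Zariski.

Definition span (A : comNzRingType) (M : lmodType A) (s : seq M) : set M :=
  [set x | exists c : nat -> A, x = \sum_(i < size s) c i *: s`_i].

Definition finite_module (A : comNzRingType) (M : lmodType A) : Prop :=
  exists s : seq M, span s = setT.

(* Proper ideals suffice: the unit ideal is generated by 1. *)
Definition noetherian (A : comNzRingType) : Prop :=
  forall I : set A, idealr_closed [in I] -> exists s : seq A^o, I = span s.

(* Only [c 0], ..., [c n] matter; [n] is the length of the chain. *)
Definition prime_chain (A : comNzRingType) (n : nat) (c : nat -> Spec A) : Prop :=
  forall i, (i < n)%N -> spec_set (c i) `<` spec_set (c i.+1).

Definition saturated_chain (A : comNzRingType) (n : nat) (c : nat -> Spec A)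
    : Prop :=
  prime_chain n c /\
  forall i, (i < n)%N ->
    ~ exists q : Spec A, spec_set (c i) `<` q /\ spec_set q `<` c i.+1.

Definition catenary (A : comNzRingType) : Prop :=
  forall p q : Spec A, spec_set p `<=` q ->
  (exists b : nat, forall n c,
     prime_chain n c -> c 0%N = p -> c n = q -> (n <= b)%N) /\
  (forall n1 c1 n2 c2,
     saturated_chain n1 c1 -> c1 0%N = p -> c1 n1 = q ->
     saturated_chain n2 c2 -> c2 0%N = p -> c2 n2 = q -> n1 = n2).

Definition is_max (P : nat -> Prop) (d : nat) : Prop :=
  P d /\ forall n, P n -> (n <= d)%N.

Section CohenMacaulay.
Variables (R : comNzRingType) (N : lmodType R).

Definition annihilator : set R := [set a | forall x : N, a *: x = 0].

(* Dimension of [R / annihilator]. *)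
Definition is_dim (d : nat) : Prop :=
  is_max (fun n => exists c : nat -> Spec R, prime_chain n c /\
    forall i, (i <= n)%N -> annihilator `<=` c i) d.

(* The submodule (s_0, ..., s_(k-1)) N. *)
Definition smul_seq (s : seq R) : set N :=
  [set x | exists y : nat -> N, x = \sum_(i < size s) s`_i *: y i].

(* [s`_i] is a nonzerodivisor on N / (s_0, ..., s_(i-1)) N, and N <> s N. *)
Definition regular_seq (s : seq R) : Prop :=
  (forall i, (i < size s)%N -> forall x : N,
     smul_seq (take i s) (s`_i *: x) -> smul_seq (take i s) x) /\
  smul_seq s <> setT.

(* The maximum of the lengths of regular sequences in [m]. *)
Definition is_depth (m : set R) (d : nat) : Prop :=
  is_max (fun n => exists s : seq R,
    [/\ size s = n, (forall a, a \in s -> m a) & regular_seq s]) d.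

(* Only meaningful when [R] is local with maximal ideal [m]; the zero module is
   Cohen-Macaulay, and otherwise depth and dimension must be equal. *)
Definition cohen_macaulay (m : set R) : Prop :=
  (forall x : N, x = 0) \/ exists d, is_depth m d /\ is_dim d.

End CohenMacaulay.

Section Localization.
Variables (A : comNzRingType) (p : Spec A).

Definition denom := {s : A | s \notin spec_set p}.

Definition denom1 : denom := exist (fun s : A => s \notin spec_set p) 1 (spec1 p).

Lemma denomM_subproof (s t : denom) : sval s * sval t \notin spec_set p.
Proof. by rewrite specM negb_or (svalP s) (svalP t). Qed.

Definition denomM (s t : denom) : denom := 
  exist (fun s : A => s \notin spec_set p) (sval s * sval t) (denomM_subproof s t).

Section Module.
Variable M : lmodType A.

Definition loc_rel (x y : M * denom) : bool :=
  `[< exists u : denom, sval u *: (sval y.2 *: x.1 - sval x.2 *: y.1) = 0 >].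

Lemma loc_relP (x y : M * denom) :
  reflect (exists u : denom,
    (sval u * sval y.2) *: x.1 = (sval u * sval x.2) *: y.1) (loc_rel x y).
Proof.
apply: (iffP (asboolP _)) => -[u xy]; exists u.
  by apply/eqP; rewrite -!scalerA -subr_eq0 -scalerBr xy.
by rewrite scalerBr !scalerA xy subrr.
Qed.

Lemma loc_rel_refl : reflexive loc_rel.
Proof. by move=> x; apply/loc_relP; exists denom1. Qed.

Lemma loc_rel_sym : symmetric loc_rel.
Proof.
by move=> x y; apply/loc_relP/loc_relP => -[u xy]; exists u; rewrite xy.
Qed.

Lemma loc_rel_trans : transitive loc_rel.
Proof.
move=> y x z /loc_relP[u xy] /loc_relP[v yz]; apply/loc_relP.
exists (denomM (denomM u v) y.2) => /=.
have -> : sval u * sval v * sval y.2 * sval z.2 =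
          (sval v * sval z.2) * (sval u * sval y.2) by ring.
rewrite -scalerA xy scalerA.
have -> : sval v * sval z.2 * (sval u * sval x.2) =
          (sval u * sval x.2) * (sval v * sval z.2) by ring.
by rewrite -scalerA yz scalerA; congr (_ *: _); ring.
Qed.

Canonical loc_equiv := EquivRel loc_rel loc_rel_refl loc_rel_sym loc_rel_trans.

Definition loc_mod : Type := {eq_quot loc_rel}.
HB.instance Definition _ : EqQuotient _ loc_rel loc_mod := EqQuotient.on loc_mod.
HB.instance Definition _ := Choice.on loc_mod.

Definition loc_frac (x : M) (s : denom) : loc_mod := \pi_loc_mod (x, s).

Lemma loc_fracP (x y : M) (s t : denom) :
  (exists u : denom, (sval u * sval t) *: x = (sval u * sval s) *: y) <->
  loc_frac x s = loc_frac y t.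
Proof.
by split=> [xy|/eqmodP/loc_relP//]; apply/eqmodP; apply/loc_relP.
Qed.

Lemma loc_fracE (z : loc_mod) : z = loc_frac (repr z).1 (repr z).2.
Proof. by rewrite /loc_frac -surjective_pairing reprK. Qed.

Lemma loc_repr (x : M) (s : denom) : exists u : denom,
  (sval u * sval s) *: (repr (loc_frac x s)).1 =
  (sval u * sval (repr (loc_frac x s)).2) *: x.
Proof. by apply/loc_fracP; rewrite -loc_fracE. Qed.

Definition loc_add (z w : loc_mod) : loc_mod :=
  loc_frac (sval (repr w).2 *: (repr z).1 + sval (repr z).2 *: (repr w).1)
           (denomM (repr z).2 (repr w).2).

Definition loc_opp (z : loc_mod) : loc_mod := loc_frac (- (repr z).1) (repr z).2.

Definition loc_zero : loc_mod := loc_frac 0 denom1.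

Lemma loc_frac_eq (x y : M) (s t : denom) :
  sval t *: x = sval s *: y -> loc_frac x s = loc_frac y t.
Proof. by move=> xy; apply/loc_fracP; exists denom1; rewrite !mul1r. Qed.

Lemma loc_addE (x y : M) (s t : denom) :
  loc_add (loc_frac x s) (loc_frac y t) =
  loc_frac (sval t *: x + sval s *: y) (denomM s t).
Proof.
have [u xu] := loc_repr x s; have [v yv] := loc_repr y t.
apply/loc_fracP; rewrite /=.
set x' := (repr (loc_frac x s)).1 in xu *; set y' := (repr (loc_frac y t)).1 in yv *.
set s' := sval (repr (loc_frac x s)).2 in xu *.
set t' := sval (repr (loc_frac y t)).2 in yv *.
exists (denomM u v); rewrite !scalerDr !scalerA /=; congr (_ + _).
- have -> : sval u * sval v * (sval s * sval t) * t' =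
    (sval v * sval t * t') * (sval u * sval s) by ring.
  by rewrite -scalerA xu scalerA; congr (_ *: _); ring.
- have -> : sval u * sval v * (sval s * sval t) * s' =
    (sval u * sval s * s') * (sval v * sval t) by ring.
  by rewrite -scalerA yv scalerA; congr (_ *: _); ring.
Qed.

Lemma loc_oppE (x : M) (s : denom) :
  loc_opp (loc_frac x s) = loc_frac (- x) s.
Proof.
have [u xu] := loc_repr x s; apply/loc_fracP; exists u.
by rewrite !scalerN xu.
Qed.

Lemma loc_ind (P : loc_mod -> Prop) :
  (forall x s, P (loc_frac x s)) -> forall z, P z.
Proof. by move=> h z; rewrite (loc_fracE z). Qed.

Lemma loc_addA : associative loc_add.
Proof.
elim/loc_ind=> x s; elim/loc_ind=> y t; elim/loc_ind=> z u.
rewrite !loc_addE; apply: loc_frac_eq => /=.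
rewrite !scalerDr !scalerA !addrA; congr (_ *: _ + _ *: _ + _ *: _); ring.
Qed.

Lemma loc_addC : commutative loc_add.
Proof.
elim/loc_ind=> x s; elim/loc_ind=> y t; rewrite !loc_addE addrC.
by apply: loc_frac_eq => /=; congr (_ *: _); ring.
Qed.

Lemma loc_add0 : left_id loc_zero loc_add.
Proof.
elim/loc_ind=> x s; rewrite loc_addE; apply: loc_frac_eq => /=.
by rewrite scaler0 add0r !scalerA; congr (_ *: _); ring.
Qed.

Lemma loc_addN : left_inverse loc_zero loc_opp loc_add.
Proof.
elim/loc_ind=> x s; rewrite loc_oppE loc_addE; apply: loc_frac_eq => /=.
by rewrite scalerN addNr !scaler0.
Qed.

HB.instance Definition _ :=
  GRing.isZmodule.Build loc_mod loc_addA loc_addC loc_add0 loc_addN.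

Lemma loc_fracD (x y : M) (s t : denom) :
  loc_frac x s + loc_frac y t = loc_frac (sval t *: x + sval s *: y) (denomM s t).
Proof. exact: loc_addE. Qed.

Lemma loc_frac0 (s : denom) : loc_frac 0 s = 0.
Proof. by apply: loc_frac_eq; rewrite !scaler0. Qed.

End Module.

(* [loc_ring] is the underlying type of A_p, [loc_mod M] that of M_p. *)
Definition loc_ring : Type := loc_mod A^o.
HB.instance Definition _ := GRing.Zmodule.on loc_ring.

Section Scale.
Variable M : lmodType A.

Definition loc_scale (a : loc_ring) (z : loc_mod M) : loc_mod M :=
  loc_frac (((repr a).1 : A) *: (repr z).1) (denomM (repr a).2 (repr z).2).

Lemma loc_scaleE (a : A) (x : M) (s t : denom) :
  loc_scale (loc_frac (a : A^o) s) (loc_frac x t) =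
  loc_frac (a *: x) (denomM s t).
Proof.
have [u au] := loc_repr (a : A^o) s; have [v xv] := loc_repr x t.
apply/loc_fracP; rewrite /=; exists (denomM u v); rewrite /= !scalerA.
set b : A := (repr (loc_frac (a : A^o) s)).1 in au *.
set s' := sval (repr (loc_frac (a : A^o) s)).2 in au *.
set t' := sval (repr (loc_frac x t)).2 in xv *.
have {}au : sval u * sval s * b = sval u * s' * a by exact: au.
have -> : sval u * sval v * (sval s * sval t) * b =
  (sval u * sval s * b) * (sval v * sval t) by ring.
by rewrite -scalerA xv scalerA au; congr (_ *: _); ring.
Qed.

End Scale.

Definition loc_one : loc_ring := loc_frac (1 : A^o) denom1.

Definition loc_mul (a b : loc_ring) : loc_ring := @loc_scale A^o a b.

Lemma loc_mulE (a b : A) (s t : denom) :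
  loc_mul (loc_frac (a : A^o) s) (loc_frac (b : A^o) t) =
  loc_frac (a * b : A^o) (denomM s t).
Proof. exact: (@loc_scaleE A^o). Qed.

Section ScaleLaws.
Variable M : lmodType A.
Notation scale := (@loc_scale M).

Lemma loc_scaleA (a b : loc_ring) (z : loc_mod M) :
  scale a (scale b z) = scale (loc_mul a b) z.
Proof.
elim/loc_ind: a => a s; elim/loc_ind: b => b t; elim/loc_ind: z => x u.
rewrite loc_mulE [scale (loc_frac b t) _]loc_scaleE !loc_scaleE.
apply: loc_frac_eq => /=; rewrite !scalerA; congr (_ *: _); ring.
Qed.

Lemma loc_scale1 : left_id loc_one scale.
Proof.
elim/loc_ind=> x s; rewrite loc_scaleE; apply: loc_frac_eq => /=.
by rewrite scale1r mul1r.
Qed.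

Lemma loc_scaleDr : right_distributive scale +%R.
Proof.
elim/loc_ind=> a s; elim/loc_ind=> x t; elim/loc_ind=> y u.
rewrite loc_fracD !loc_scaleE loc_fracD; apply: loc_frac_eq => /=.
by rewrite !scalerDr !scalerA; congr (_ *: _ + _ *: _); ring.
Qed.

Lemma loc_scaleDl (z : loc_mod M) :
  {morph scale^~ z : a b / a + b}.
Proof.
elim/loc_ind: z => x u; elim/loc_ind=> a s; elim/loc_ind=> b t.
rewrite [X in scale X]loc_fracD !loc_scaleE loc_fracD; apply: loc_frac_eq => /=.
rewrite scalerDl !scalerDr !scalerA; congr (_ *: _ + _ *: _).
- by rewrite /GRing.scale /=; ring.
- by rewrite /GRing.scale /=; ring.
Qed.

End ScaleLaws.

Lemma loc_mulA : associative loc_mul.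
Proof. by move=> a b c; apply: loc_scaleA. Qed.

Lemma loc_mulC : commutative loc_mul.
Proof.
elim/loc_ind=> a s; elim/loc_ind=> b t; rewrite !loc_mulE.
by apply: loc_frac_eq => /=; rewrite /GRing.scale /=; ring.
Qed.

Lemma loc_mul1 : left_id loc_one loc_mul.
Proof. exact: loc_scale1. Qed.

Lemma loc_mulDl : left_distributive loc_mul +%R.
Proof. by move=> a b c; apply: (@loc_scaleDl A^o). Qed.

Lemma loc_one_neq0 : loc_one != 0 :> loc_ring.
Proof.
apply/eqP => /loc_fracP[u]; rewrite scaler0 /GRing.scale /= !mulr1 => u0.
by have := svalP u; rewrite u0 spec0.
Qed.

HB.instance Definition _ := GRing.Zmodule_isComNzRing.Build loc_ring
  loc_mulA loc_mulC loc_mul1 loc_mulDl loc_one_neq0.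

HB.instance Definition _ (M : lmodType A) :=
  GRing.Zmodule_isLmodule.Build loc_ring (loc_mod M)
    (@loc_scaleA M) (@loc_scale1 M) (@loc_scaleDr M) (@loc_scaleDl M).

(* The extension p A_p of p. *)
Definition loc_max : set loc_ring :=
  [set z | exists (a : A) (s : denom), a \in spec_set p /\ z = loc_frac (a : A^o) s].

Lemma loc_maxP (a : A) (s : denom) :
  loc_max (loc_frac (a : A^o) s) <-> a \in spec_set p.
Proof.
split=> [[b [t [pb /loc_fracP[u]]]]|pa]; last by exists a, s.
rewrite /GRing.scale /= => ab.
have : sval u * sval t * a \in spec_set p by rewrite ab specMr.
by rewrite !specM (negPf (svalP u)) (negPf (svalP t)).
Qed.

Lemma loc_max_ideal : idealr_closed [in loc_max].
Proof.
split.
- by apply/mem_set; exists 0, denom1; rewrite spec0.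
- apply/negP => /set_mem/loc_maxP; apply/negP; exact: spec1.
- move=> c z w /set_mem[a [s [pa ->]]] /set_mem[b [t [pb ->]]].
  elim/loc_ind: c => c u; apply/mem_set.
  rewrite [_ * _]loc_mulE [_ + _]loc_fracD; apply/loc_maxP.
  by rewrite /GRing.scale /= specMD ?specMr.
Qed.

Lemma loc_max_nonunit (I : set loc_ring) :
  idealr_closed [in I] -> I `<=` loc_max.
Proof.
move=> [_ I1 IMD]; elim/loc_ind=> a s Ia; apply/loc_maxP; apply: contraT => pa.
pose t : denom := exist (fun s : A => s \notin spec_set p) a pa.
have I0 : 0 \in I.
  by have := IMD (-1) _ _ (mem_set Ia) (mem_set Ia); rewrite mulN1r addNr.
move: I1; apply: contraNT => _.
have := IMD (loc_frac (sval s : A^o) t) _ _ (mem_set Ia) I0; rewrite addr0.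
rewrite [_ * _]loc_mulE.
have -> // : loc_frac (sval s * a : A^o) (denomM t s) = loc_one.
by apply: loc_frac_eq; rewrite /GRing.scale /=; ring.
Qed.

Lemma loc_ring_local : local_ring loc_max.
Proof.
split=> [|n [nI nmax]].
  split=> [|I II le]; first exact: loc_max_ideal.
  by apply/seteqP; split=> //; exact: loc_max_nonunit.
by rewrite (nmax _ loc_max_ideal)//; exact: loc_max_nonunit.
Qed.

End Localization.

Definition CM_locus (A : comNzRingType) (M : lmodType A) : set (Spec A) :=
  [set p | cohen_macaulay (loc_mod p M) (loc_max (p := p))].

Definition non_CM_ring_locus (A : comNzRingType) : set (Spec A) :=
  [set p | ~ cohen_macaulay (loc_ring p)^o (loc_max (p := p))].

Arguments non_CM_ring_locus A : clear implicits.

(* Main.v *)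
From mathcomp Require Import all_boot all_order all_algebra.
From mathcomp Require Import all_classical topology.
From mathcomp Require Import ring.
Require Import Defs.

(** The Cohen-Macaulay locus [U] of [M] is stable under generalization
    ([CM_locus_generalize]). By Nagata's criterion ([nagata_open]) it is then open
    as soon as every [p] in [U] has a neighbourhood [D(f)] with [V(p)] meeting
    [D(f)] inside [U].

    Let [Z] be the finite set of primes where [A] is not Cohen-Macaulay; it is
    stable under specialization. Choose [g] outside [p] but in every prime of [Z]
    that is not contained in [p]. If [p] is in [Z], then [V(p)] lies in [Z], so
    [p] is the only point of [V(p)] where [g] does not vanish, and it is in [U].
    If [p] is not in [Z], then neither is any point of [V(p)] in [D(g)], and it
    remains to pass from [A] to [M] on [V(p)].

    The passage goes through [A / p]. If a finite module [N] is Cohen-Macaulay at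
    [p], then for the [q] in [V(p)] close to [p], [N] is Cohen-Macaulay at [q] if
    and only if [A / p] is ([CM_at_residue]). Indeed, a maximal regular sequence
    for [N] at [p] stays regular nearby, and cutting by regular elements does not
    affect the Cohen-Macaulay property ([CM_at_quotient]), so [p] may be supposed
    minimal in the support of [N]. A prime filtration of [N] then becomes, near
    [p], a filtration by copies of [A / p] ([minimal_filtered]). A sequence
    regular on [A / p] is regular on [N], and when [A / p] has depth zero so does
    its extension [N]; hence the two modules are Cohen-Macaulay together
    ([filtered_CM], [CM_filtered]). Applying this with [N = A] and with [N = M],
    one gets from [A] to [A / p] and from there to [M].

    The underlying dimension theory is Krull's principal ideal theorem
    ([krull_principal_ideal]). It makes dimension drop by one along a regular
    element, gives unmixedness of Cohen-Macaulay modules ([CM_at_associated]),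
    and so their stability under generalization ([CM_at_generalize]).

    All of this takes place in quotients [M / K] of a fixed module, where being
    true at [q] means being true after multiplication by some element outside
    [q]. [cohen_macaulay_locE] translates the result to the depth and dimension of
    the localized module. *)

Set Implicit Arguments.
Unset Strict Implicit.
Unset Printing Implicit Defensive.

Import GRing.Theory.
Local Open Scope classical_set_scope.
Local Open Scope ring_scope.

(** * Submodules and finite generation *)

Section Submodules.
Variables (A : comNzRingType) (M : lmodType A).
Implicit Types (K L : set M) (x y : M) (a z : A).

(** A quotient module [M / K] is handled through the submodule [K], with [M]
    fixed: passing to [(M / K) / z(M / K)] enlarges [K] to [K + zM]. *)
Definition submodule K : Prop :=
  K 0 /\ forall a x y, K x -> K y -> K (a *: x + y).

Lemma submod0 K : submodule K -> K 0.
Proof. by case. Qed.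

Lemma submodD K x y : submodule K -> K x -> K y -> K (x + y).
Proof. by move=> [_ h] Kx Ky; rewrite -[x]scale1r; apply: h. Qed.

Lemma submodZ K a x : submodule K -> K x -> K (a *: x).
Proof. by move=> [K0 h] Kx; rewrite -[_ *: _]addr0; apply: h. Qed.

Lemma submodN K x : submodule K -> K x -> K (- x).
Proof. by move=> sK Kx; rewrite -scaleN1r; apply: submodZ. Qed.

Lemma submodB K x y : submodule K -> K x -> K y -> K (x - y).
Proof. by move=> sK Kx Ky; apply: submodD => //; apply: submodN. Qed.

Lemma submodT : submodule setT. Proof. by []. Qed.

Lemma submod_0 : submodule [set 0].
Proof. by split=> // a x y /= -> ->; rewrite scaler0 addr0. Qed.

Definition addm K L : set M := [set x | exists k l, [/\ K k, L l & x = k + l]].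

Definition cycm y : set M := [set x | exists a, x = a *: y].

Definition mulm z : set M := [set x | exists w, x = z *: w].

Lemma submod_add K L : submodule K -> submodule L -> submodule (addm K L).
Proof.
move=> sK sL; split; first by exists 0, 0; split; rewrite ?addr0 //; apply: submod0.
move=> a _ _ [k [l [Kk Ll ->]]] [k' [l' [Kk' Ll' ->]]].
exists (a *: k + k'), (a *: l + l'); split; [exact: sK.2|exact: sL.2|].
by rewrite scalerDr addrACA.
Qed.

Lemma submod_cyc y : submodule (cycm y).
Proof.
split; first by exists 0; rewrite scale0r.
by move=> a _ _ [b ->] [c ->]; exists (a * b + c); rewrite scalerDl scalerA.
Qed.

Lemma submod_mul z : submodule (mulm z).
Proof.
split; first by exists 0; rewrite scaler0.
move=> a _ _ [v ->] [w ->]; exists (a *: v + w).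
by rewrite scalerDr !scalerA mulrC.
Qed.

Lemma submodI K L : submodule K -> submodule L -> submodule (K `&` L).
Proof.
move=> sK sL; split; first by split; apply: submod0.
by move=> a x y [Kx Lx] [Ky Ly]; split; [apply: sK.2|apply: sL.2].
Qed.

Lemma subset_addl K L : submodule L -> K `<=` addm K L.
Proof. by move=> sL x Kx; exists x, 0; split; rewrite ?addr0 //; apply: submod0. Qed.

Lemma subset_addr K L : submodule K -> L `<=` addm K L.
Proof. by move=> sL x Kx; exists 0, x; split; rewrite ?add0r //; apply: submod0. Qed.

Lemma addm_sub K L N : submodule N -> K `<=` N -> L `<=` N -> addm K L `<=` N.
Proof. by move=> sN KN LN _ [k [l [/KN Kk /LN Ll ->]]]; apply: submodD. Qed.

Lemma addmC K L : addm K L = addm L K.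
Proof. by apply/seteqP; split=> _ [k [l [? ? ->]]]; exists l, k; rewrite addrC. Qed.

Lemma addmA K L N : addm K (addm L N) = addm (addm K L) N.
Proof.
apply/seteqP; split.
  move=> _ [k [_ [Kk [l [n [Ll Nn ->]]] ->]]]; rewrite addrA.
  by exists (k + l), n; split=> //; exists k, l.
move=> _ [_ [n [[k [l [Kk Ll ->]]] Nn ->]]]; rewrite -addrA.
by exists k, (l + n); split=> //; exists l, n.
Qed.

Lemma addmAC K L N : addm (addm K L) N = addm (addm K N) L.
Proof. by rewrite -!addmA (addmC L). Qed.

(** The annihilator of [M / K]. *)
Definition colon K : set A := [set a | forall x, K (a *: x)].

Lemma submod_span (s : seq M) : submodule (span s).
Proof.
split; first by exists (fun=> 0); rewrite big1 // => i _; rewrite scale0r.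
move=> a _ _ [c ->] [d ->]; exists (fun i => a * c i + d i).
rewrite scaler_sumr -big_split /=; apply: eq_bigr => i _.
by rewrite scalerDl scalerA.
Qed.

Lemma span_cons y (s : seq M) : span (y :: s) = addm (cycm y) (span s).
Proof.
apply/seteqP; split.
  move=> _ [c ->]; rewrite big_ord_recl /=.
  exists (c 0%N *: y), (\sum_(i < size s) c i.+1 *: s`_i); split=> //.
  - by exists (c 0%N).
  - by exists (fun i => c i.+1).
move=> _ [_ [_ [[a ->] [c ->] ->]]].
by exists (fun i => if i is j.+1 then c j else a); rewrite big_ord_recl.
Qed.

Lemma span_nil : span ([::] : seq M) = [set 0].
Proof.
apply/seteqP; split=> [_ [c ->]|_ ->]; first by rewrite big_ord0.
by exists (fun=> 0); rewrite big_ord0.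
Qed.

Lemma mem_span (s : seq M) x : x \in s -> span s x.
Proof.
elim: s => //= y s IH; rewrite inE span_cons => /orP[/eqP <-|/IH].
  by apply: subset_addl; [exact: submod_span|exists 1; rewrite scale1r].
exact: (subset_addr (submod_cyc y)).
Qed.

Lemma span_sub (s : seq M) K :
  submodule K -> (forall x, x \in s -> K x) -> span s `<=` K.
Proof.
move=> sK; elim: s => [|y s IH] sub; first by rewrite span_nil => _ ->; apply: submod0.
rewrite span_cons; apply: addm_sub => //.
  by move=> _ [a ->]; apply: submodZ => //; apply: sub; rewrite mem_head.
by apply: IH => x xs; apply: sub; rewrite inE xs orbT.
Qed.

Definition noetherian_module : Prop :=
  forall K, submodule K -> exists s : seq M, K = span s.

End Submodules.

(** * Chain conditions *)

Lemma noetherian_ideal (A : comNzRingType) :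
  noetherian A -> noetherian_module A^o.
Proof.
move=> nA I sI; have [I1|nI1] := pselect (I (1 : A)).
  exists [:: 1 : A^o]; apply/seteqP; split=> [a _|a _].
    rewrite -[a]mulr1; apply: (submodZ a (submod_span _) (x := 1 : A^o)).
    exact/mem_span/mem_head.
  by rewrite -[a]mulr1; apply: (submodZ a sI I1).
apply: nA; split; first exact: mem_set (submod0 sI).
  by apply/negP => /set_mem h; apply: nI1.
by move=> a x y /set_mem Ix /set_mem Iy; apply/mem_set; apply: sI.2.
Qed.

(** Induction on the number of generators [y :: s]: the coefficients of [y] in
    elements of [K] form a finitely generated ideal, and lifting its generators
    to [K] leaves only the part of [K] inside the span of [s]. *)
Lemma finite_noetherian (A : comNzRingType) (M : lmodType A) :
  noetherian A -> finite_module M -> noetherian_module M.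
Proof.
move=> /noetherian_ideal nA [s sT] K sK.
have : K `<=` span s by rewrite sT.
elim: s K sK {sT} => [|y s IH] K sK.
  rewrite span_nil => K0; exists [::]; rewrite span_nil.
  by apply/seteqP; split=> // _ ->; apply: submod0.
rewrite span_cons => Ks.
pose I : set A^o := [set a | exists2 x, span s x & K ((a : A) *: y + x)].
have sI : submodule I.
  split; first exists 0.
  - exact: submod0 (submod_span _).
  - by rewrite scale0r addr0; apply: submod0.
  move=> a b c [x sx Kx] [w sw Kw]; exists (a *: x + w); first exact: (submod_span s).2.
  rewrite scalerDl addrACA -[a *: b]/(a * b) -scalerA -scalerDr.
  exact: sK.2.
have [t tI] := nA I sI.
have lift_ex (a : A) : exists x, I a -> span s x /\ K (a *: y + x).
  have [[x ? ?]|nI] := pselect (I a); first by exists x.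
  by exists 0.
have [g gP] := choice lift_ex.
have [u uK] := IH (K `&` span s) (submodI sK (submod_span s)) (@subIsetr _ _ _).
exists (u ++ [seq (a : A) *: y + g a | a <- t]).
have tI' (a : A) : a \in t -> I a by rewrite tI; apply: mem_span.
apply/seteqP; split; last first.
  apply: span_sub => // x.
  rewrite mem_cat => /orP[/mem_span|/mapP[a /tI' /gP[_ Ka] ->]//].
  by rewrite -uK => -[].
set L := span _; have sL : submodule L by apply: submod_span.
have uL : K `&` span s `<=` L.
  by rewrite uK; apply: span_sub => // x xu; apply: mem_span; rewrite mem_cat xu.
have sub (a : A) : I a -> exists2 x, span s x & K (a *: y + x) /\ L (a *: y + x).
  rewrite tI => ha.
  pose J : set A^o := [set a | exists2 x, span s x &
    K ((a : A) *: y + x) /\ L ((a : A) *: y + x)].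
  apply: (@span_sub _ A^o t J) ha => [|b bt].
    split; first exists 0.
    - exact: submod0 (submod_span _).
    - by rewrite scale0r addr0; split; apply: submod0.
    move=> c b d [x sx [Kx Lx]] [w sw [Kw Lw]].
    exists (c *: x + w); first exact: (submod_span s).2.
    rewrite scalerDl addrACA -[c *: b]/(c * b) -scalerA -scalerDr.
    by split; [apply: sK.2|apply: sL.2].
  have [sg Kg] := gP b (tI' b bt); exists (g b) => //; split=> //.
  by apply: mem_span; rewrite mem_cat (map_f (fun a : A => a *: y + g a)) ?orbT.
move=> x Kx; have [_ [w [[a ->] sw xE]]] := Ks x Kx.
have Ia : I a by exists w; rewrite -?xE.
have [v sv [Kv Lv]] := sub a Ia.
rewrite -[x](subrK (a *: y + v)); apply: submodD => //; apply: uL; split.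
  exact: submodB.
by rewrite xE opprD addrACA subrr add0r; apply: submodB => //; apply: submod_span.
Qed.

Section Noetherian.
Variables (A : comNzRingType) (M : lmodType A).
Hypothesis nM : noetherian_module M.

Lemma ascending_stop (K : nat -> set M) :
  (forall n, submodule (K n)) -> (forall n, K n `<=` K n.+1) ->
  exists n, K n.+1 `<=` K n.
Proof.
move=> sK incr.
have mono m n : (m <= n)%N -> K m `<=` K n.
  by move=> /subnK <-; elim: (_ - _)%N => [//|k IH] x /IH; apply: incr.
pose U : set M := [set x | exists n, K n x].
have sU : submodule U.
  split; first by exists 0%N; apply: submod0.
  move=> a x y [m Kx] [n Ky]; exists (maxn m n).
  by apply: (sK _).2; [apply: mono Kx|apply: mono Ky]; rewrite ?leq_maxl ?leq_maxr.
have [s Us] := nM sU.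
suff [n sn] : exists n, forall x, x \in s -> K n x.
  exists n => x Kx; have : U x by exists n.+1.
  by rewrite Us; apply: span_sub.
have : forall x, x \in s -> U x by rewrite Us => x; apply: mem_span.
elim: s {Us} => [|y s IH] sub; first by exists 0%N.
have [|n hn] := IH; first by move=> x xs; apply: sub; rewrite inE xs orbT.
have [m hm] := sub y (mem_head _ _).
exists (maxn m n) => x; rewrite inE => /orP[/eqP ->|/hn].
  by apply: mono hm; rewrite leq_maxl.
by apply: mono; rewrite leq_maxr.
Qed.

Lemma noetherian_maximal (F : set M -> Prop) K0 :
  F K0 -> (forall K, F K -> submodule K) ->
  exists K, F K /\ forall L, F L -> K `<=` L -> L `<=` K.
Proof.
move=> F0 Fs; apply: contrapT => /forallNP nomax.
have step (K : {K | F K}) : exists L : {K | F K},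
    sval K `<=` sval L /\ ~ sval L `<=` sval K.
  have := nomax (sval K) => /not_andP[/(_ (svalP K))//|/existsNP[L]].
  by move=> /not_implyP[FL /not_implyP[KL LK]]; exists (exist _ L FL).
have [f fP] := choice step.
pose c n := iter n f (exist _ K0 F0).
have [n] := @ascending_stop (fun n => sval (c n)) (fun n => Fs _ (svalP (c n)))
  (fun n => (fP (c n)).1).
exact: (fP (c n)).2.
Qed.

End Noetherian.

(** * Primes and submodules seen locally at a prime *)

Section Primes.
Variable A : comNzRingType.
Implicit Types (p q : Spec A) (a b : A).

Lemma prime0 p : spec_set p 0. Proof. exact: set_mem (spec0 p). Qed.

Lemma prime1 p : ~ spec_set p 1.
Proof. by move=> /mem_set; apply/negP/spec1. Qed.

Lemma prime_mull p a b : spec_set p b -> spec_set p (a * b).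
Proof. by move=> /mem_set pb; apply/set_mem/specMr. Qed.

Lemma prime_mulr p a b : spec_set p a -> spec_set p (a * b).
Proof. by rewrite mulrC; apply: prime_mull. Qed.

Lemma primeD p a b : spec_set p a -> spec_set p b -> spec_set p (a + b).
Proof.
by move=> /mem_set pa /mem_set pb; apply: set_mem; rewrite -[a]mul1r specMD.
Qed.

Lemma primeN p a : spec_set p a -> spec_set p (- a).
Proof. by move=> pa; rewrite -mulN1r; apply: prime_mull. Qed.

Lemma primeM p a b : spec_set p (a * b) -> spec_set p a \/ spec_set p b.
Proof.
by move=> /mem_set; rewrite specM => /orP[] /set_mem; [left|right].
Qed.

Lemma nprimeM p a b : ~ spec_set p a -> ~ spec_set p b -> ~ spec_set p (a * b).
Proof. by move=> pa pb /primeM[]. Qed.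

Lemma primeX p a n : spec_set p (a ^+ n) -> spec_set p a.
Proof. by elim: n => [/prime1|n IH] //; rewrite exprS => /primeM[//|/IH]. Qed.

Lemma nprimeBr p a b : ~ spec_set p a -> spec_set p b -> ~ spec_set p (a - b).
Proof. by move=> pa pb pab; apply: pa; rewrite -[a](subrK b); apply: primeD. Qed.

Lemma submod_prime p : submodule (M := A^o) (spec_set p).
Proof.
split; first exact: prime0.
by move=> a x y px py; apply: primeD => //; apply: prime_mull.
Qed.

Lemma spec_antisym p q : spec_set p `<=` q -> spec_set q `<=` p -> p = q.
Proof. by move=> pq qp; apply: spec_eq; apply/seteqP. Qed.

Lemma prime_build (I : set A) :
  submodule (M := A^o) I -> ~ I 1 -> (forall a b, I (a * b) -> I a \/ I b) ->
  exists p, spec_set p = I.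
Proof.
move=> sI I1 IM; suff Ip : prime_ideal I by exists (MkSpec Ip).
split; [split|].
- exact: mem_set (submod0 sI).
- by apply/negP => /set_mem.
- by move=> a x y /set_mem Ix /set_mem Iy; apply/mem_set; apply: sI.2.
- move=> a b /set_mem/IM[] h; apply/orP; [left|right]; exact: mem_set.
Qed.

End Primes.

Section Saturation.
Variables (A : comNzRingType) (M : lmodType A).
Implicit Types (p q : Spec A) (K L : set M) (x y : M) (a z s : A).

(** The preimage in [M] of the localization of [K] at [p]. *)
Definition sat p K : set M :=
  [set x | exists2 s, ~ spec_set p s & K (s *: x)].

Lemma sat_sub p K : K `<=` sat p K.
Proof. by move=> x Kx; exists 1; rewrite ?scale1r //; apply: prime1. Qed.

Lemma satS p K L : K `<=` L -> sat p K `<=` sat p L.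
Proof. by move=> KL x [s ps Kx]; exists s => //; apply: KL. Qed.

Lemma satW p q K : spec_set p `<=` q -> sat q K `<=` sat p K.
Proof. by move=> pq x [s qs Kx]; exists s => // /pq. Qed.

Lemma satZ p K s x : ~ spec_set p s -> sat p K (s *: x) -> sat p K x.
Proof.
move=> ps [t pt Kx]; exists (t * s); last by rewrite -scalerA.
exact: nprimeM.
Qed.

Lemma sat_idem p K : sat p (sat p K) `<=` sat p K.
Proof. by move=> x [s ps /satZ]; apply. Qed.

Lemma submod_sat p K : submodule K -> submodule (sat p K).
Proof.
move=> sK; split; first exact: sat_sub (submod0 sK).
move=> a x y [s ps Kx] [t pt Ky]; exists (s * t); first exact: nprimeM.
rewrite scalerDr; apply: submodD => //.
  rewrite scalerA; have -> : s * t * a = (t * a) * s by ring.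
  by rewrite -scalerA; apply: submodZ.
by rewrite -scalerA; apply: submodZ.
Qed.

Lemma sat_trans p K L : K `<=` sat p L -> sat p K `<=` sat p L.
Proof. by move=> KL x /(satS KL)/sat_idem. Qed.

(** The denominators needed for finitely many generators multiply to a common
    one. *)
Lemma sat_uniform p K L : noetherian_module M ->
  submodule K -> submodule L -> L `<=` sat p K ->
  exists2 s, ~ spec_set p s & forall x, L x -> K (s *: x).
Proof.
move=> nM sK sL; have [g ->] := nM L sL.
elim: g => [|y g IH] sub.
  exists 1; first exact: prime1.
  by rewrite span_nil => _ ->; rewrite scaler0; apply: submod0.
have [|s ps Ks] := IH.
  by apply: subset_trans sub; rewrite span_cons; apply/subset_addr/submod_cyc.
have [t pt Kt] := sub y (mem_span (mem_head _ _)).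
exists (s * t); first exact: nprimeM.
rewrite span_cons => _ [_ [x [[a ->] /Ks Kx ->]]].
rewrite scalerDr; apply: submodD => //.
  rewrite scalerA; have -> : s * t * a = (s * a) * t by ring.
  by rewrite -scalerA; apply: submodZ.
by rewrite mulrC -scalerA; apply: submodZ.
Qed.

Lemma colonS K L : K `<=` L -> colon K `<=` colon L.
Proof. by move=> KL a Ka x; apply: KL. Qed.

(** The support of a finite module is cut out by its annihilator. *)
Lemma colon_supp p K : noetherian_module M -> submodule K ->
  colon K `<=` p <-> exists x, ~ sat p K x.
Proof.
move=> nM sK; split=> [Kp|[x px] a Ka].
  apply: contrapT => /forallNP all; have [||s ps Ks] := @sat_uniform p K setT nM sK.
  - exact: submodT.
  - by move=> x _; apply: contrapT; apply: all.
  by apply: ps; apply: Kp => x; apply: Ks.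
by apply: contrapT => pa; apply: px; exists a.
Qed.

(** Nakayama's lemma. The hypothesis says that [L] is contained in [K + pL]
    locally at [p], without mentioning products of ideals and modules. Among the
    submodules that contain [K], are saturated at [p] and do not contain [L], a
    maximal one would contain [pL], hence [L]. *)
Lemma nakayama p K L : noetherian_module M -> submodule K -> submodule L ->
  (forall N, submodule N -> K `<=` N -> sat p N `<=` N ->
     (forall a x, spec_set p a -> L x -> N (a *: x)) -> L `<=` N) ->
  L `<=` sat p K.
Proof.
move=> nM sK sL Lgen; apply: contrapT => nL.
pose F N := [/\ submodule N, K `<=` N, sat p N `<=` N & ~ L `<=` N].
have F0 : F (sat p K).
  by split=> //; [apply: submod_sat|apply: sat_sub|apply: sat_idem].
have Fs N : F N -> submodule N by case.
have [N [[sN KN pN nLN] Nmax]] := noetherian_maximal nM F0 Fs.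
apply: nLN; apply: (Lgen) => // a x pa Lx; apply: contrapT => nNx.
have sN' : submodule (addm N (cycm (a *: x))).
  by apply: submod_add => //; apply: submod_cyc.
have NN' : N `<=` sat p (addm N (cycm (a *: x))).
  by apply: subset_trans (@sat_sub _ _); apply/subset_addl/submod_cyc.
have LN' : L `<=` sat p (addm N (cycm (a *: x))).
  apply: contrapT => nLN'; apply: nNx.
  apply: (Nmax (sat p (addm N (cycm (a *: x))))) => //.
    split=> //; first exact: submod_sat; first exact: subset_trans NN'.
    exact: sat_idem.
  by apply/sat_sub/subset_addr => //; exists 1; rewrite scale1r.
have [s ps [k [_ [Nk [b ->] sx]]]] := LN' x Lx.
apply: nNx; apply: submodZ => //; apply: pN; exists (s - b * a).
  by apply: nprimeBr => //; apply: prime_mull.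
by rewrite scalerBl sx -scalerA addrK.
Qed.

End Saturation.

(** * Prime filtrations, associated and minimal primes *)

Section PrimeLists.
Variable A : comNzRingType.
Implicit Types (p q P : Spec A) (Ps : seq (Spec A)) (I : set A).

(** The typical use is to keep a prime [q] away from finitely many closed sets:
    [f] does not vanish at [q] but vanishes on those that do not contain [q]. *)
Lemma separate Ps q : exists f, ~ spec_set q f /\
  forall P, P \in Ps -> spec_set P f \/ spec_set P `<=` q.
Proof.
elim: Ps => [|P Ps [f [qf fP]]]; first by exists 1; split=> //; apply: prime1.
have [Pq|/existsNP[g /not_implyP[Pg qg]]] := pselect (spec_set P `<=` q).
  by exists f; split=> // P'; rewrite inE => /orP[/eqP ->|/fP //]; right.
exists (g * f); split; first exact: nprimeM.
move=> P'; rewrite inE => /orP[/eqP ->|/fP[P'f|]]; [left|left|by right].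
  exact: prime_mulr.
exact: prime_mull.
Qed.

(** Primes of the list inside its head [P] may be dropped. If the remaining ones
    do not cover [I], say at [a], then adding to [a] a multiple of [f] that
    avoids [P] gives an element of [I] in no prime of the list. *)
Lemma prime_avoidance Ps I : submodule (M := A^o) I ->
  (forall a, I a -> exists2 P, P \in Ps & spec_set P a) ->
  exists2 P, P \in Ps & I `<=` P.
Proof.
move=> sI; have [n] := ubnP (size Ps); elim: n Ps => // n IH [|P Ps] /= sz cover.
  by have [] := cover _ (submod0 sI).
pose Qs := [seq Q <- Ps | ~~ `[< spec_set Q `<=` P >]].
have QsP Q : Q \in Qs -> Q \in Ps by rewrite mem_filter => /andP[].
have coverQ a : I a -> ~ spec_set P a -> exists2 Q, Q \in Qs & spec_set Q a.
  move=> Ia nPa; have [Q] := cover a Ia.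
  rewrite inE => /orP[/eqP -> //|QPs Qa]; exists Q => //.
  by rewrite mem_filter QPs andbT; apply/asboolPn => /(_ a Qa).
have [all|/existsNP[a /not_implyP[Ia na]]] :=
  pselect (forall a, I a -> exists2 Q, Q \in Qs & spec_set Q a).
  have [|Q QQs IQ] := IH Qs _ all.
    by rewrite size_filter; apply: leq_ltn_trans (count_size _ _) _; rewrite -ltnS.
  by exists Q => //; rewrite inE QsP ?orbT.
exists P; first exact: mem_head.
move=> b Ib; apply: contrapT => Pb.
have Pa : spec_set P a by apply: contrapT => /(coverQ a Ia).
have [f [Pf fQ]] := separate Qs P.
have nPc : ~ spec_set P (a + f * b).
  move=> Pc; apply: (nprimeM Pf Pb); rewrite -[f * b](addKr a).
  by apply: primeD => //; apply: primeN.
have Ic : I (a + f * b) by apply: (submodD sI Ia); apply: (submodZ f sI Ib).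
have [Q QQs Qc] := coverQ _ Ic nPc.
apply: na; exists Q => //; rewrite -[a](addrK (f * b)).
apply: primeD => //; apply/primeN/prime_mulr.
have [//|QP] := fQ Q QQs.
by move: QQs; rewrite mem_filter => /andP[/asboolPn].
Qed.

Lemma minimal_in_list Ps q :
  (exists2 P, P \in Ps & spec_set P `<=` q) ->
  exists P, [/\ P \in Ps, spec_set P `<=` q &
    forall Q, Q \in Ps -> spec_set Q `<=` P -> Q = P].
Proof.
elim: Ps => [[]//|R Ps IH] [P0 P0Ps P0q].
have [ex|nex] := pselect (exists2 P, P \in Ps & spec_set P `<=` q).
  have [P [PPs Pq Pmin]] := IH ex; have [RP|nRP] := pselect (spec_set R `<=` P).
    exists R; split; [exact: mem_head|exact: subset_trans Pq|].
    move=> Q; rewrite inE => /orP[/eqP //|QPs] QR.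
    have QP := Pmin Q QPs (subset_trans QR RP).
    by apply: spec_antisym => //; rewrite QP.
  exists P; split=> //; first by rewrite inE PPs orbT.
  by move=> Q; rewrite inE => /orP[/eqP ->|/Pmin].
have Rq : spec_set R `<=` q.
  move: P0Ps; rewrite inE => /orP[/eqP <- //|P0Ps].
  by case: nex; exists P0.
exists R; split=> //; first exact: mem_head.
move=> Q; rewrite inE => /orP[/eqP //|QPs QR].
by case: nex; exists Q => //; apply: subset_trans Rq.
Qed.

Definition minimal_over p I : Prop :=
  I `<=` p /\ forall q, I `<=` q -> spec_set q `<=` p -> q = p.

End PrimeLists.

Section PrimeFiltrations.
Variables (A : comNzRingType) (M : lmodType A).
Hypothesis nA : noetherian_module A^o.
Implicit Types (p q P Q : Spec A) (K L : set M) (x y : M) (a b z : A).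

Definition associated K P : Prop :=
  exists y, forall a, spec_set P a <-> K (a *: y).

(** A maximal annihilator of a nonzero multiple of [x] is prime. *)
Lemma associated_exists K x : submodule K -> ~ K x ->
  exists P a, forall b, spec_set P b <-> K (b *: (a *: x)).
Proof.
move=> sK nx; pose ann a : set A := [set b | K (b *: (a *: x))].
pose F I := exists2 a, ~ K (a *: x) & I = ann a.
have sann a : submodule (M := A^o) (ann a).
  split; first by rewrite /ann /= scale0r; apply: submod0.
  by move=> c b d Kb Kd; rewrite /ann /= scalerDl -scalerA; apply: sK.2.
have F0 : F (ann 1) by exists 1; rewrite ?scale1r.
have [_ [[a nax ->] amax]] := @noetherian_maximal A A^o nA F (ann 1) F0
  (fun I '(ex_intro2 a _ E) => eq_ind_r (fun J => submodule J) (sann a) E).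
have [||P PE] := prime_build (sann a); first by rewrite /ann /= scale1r.
  move=> b c abc; have [acx|nacx] := pselect (ann a c); first by right.
  left; apply: (amax (ann (c * a))).
  - by exists (c * a) => //; rewrite -scalerA.
  - by move=> d ad; rewrite /ann /= -scalerA scalerA mulrC -scalerA; apply: submodZ.
  - by rewrite /ann /= -scalerA scalerA.
by exists P, a => b; rewrite PE.
Qed.

(** A filtration of [M / K] with cyclic quotients [A / P], read from the bottom
    up; each step divides out the copy of [A / P] generated by [y]. *)
Inductive prime_filtration : set M -> seq (Spec A) -> Prop :=
| prime_filtration_nil : prime_filtration setT [::]
| prime_filtration_cons K y P Ps : submodule K ->
    (forall a, spec_set P a <-> K (a *: y)) ->
    prime_filtration (addm K (cycm y)) Ps -> prime_filtration K (P :: Ps).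

Lemma prime_filtration_exists K : noetherian_module M -> submodule K ->
  exists Ps, prime_filtration K Ps.
Proof.
move=> nM sK; apply: contrapT => nK.
pose F L := submodule L /\ ~ exists Ps, prime_filtration L Ps.
have [L [[sL nL] Lmax]] :=
  @noetherian_maximal A M nM F K (conj sK nK) (fun _ => @proj1 _ _).
have [x nLx] : exists x, ~ L x.
  apply: contrapT => /forallNP all; apply: nL; exists [::].
  suff -> : L = setT by constructor.
  by apply/seteqP; split=> // x _; apply: contrapT; apply: all.
have [P [a Pax]] := associated_exists sL nLx; set y := a *: x in Pax.
have nLy : ~ L y by rewrite -[y]scale1r -Pax; apply: prime1.
have LL' : L `<=` addm L (cycm y) by apply/subset_addl/submod_cyc.
apply: nLy; apply: (Lmax (addm L (cycm y))) => //.
  split; first by apply: submod_add => //; apply: submod_cyc.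
  move=> [Ps hPs]; apply: nL; exists (P :: Ps).
  exact: prime_filtration_cons hPs.
by apply: subset_addr => //; exists 1; rewrite scale1r.
Qed.

Lemma prime_filtration_colon K Ps : prime_filtration K Ps ->
  forall P, P \in Ps -> colon K `<=` P.
Proof.
elim=> {K Ps} [//|K y P Ps sK PE _ IH] Q; rewrite inE => /orP[/eqP ->|/IH QK].
  by move=> a Ka; apply/PE.
by apply: subset_trans QK; apply: colonS; apply/subset_addl/submod_cyc.
Qed.

Lemma prime_filtration_power K Ps f : prime_filtration K Ps ->
  (forall P, P \in Ps -> spec_set P f) -> exists n, colon K (f ^+ n).
Proof.
elim=> {K Ps} [|K y P Ps sK PE _ IH] Pf; first by exists 0%N.
have [|n fn] := IH; first by move=> Q QPs; apply: Pf; rewrite inE QPs orbT.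
exists n.+1 => x; have [k [_ [Kk [c ->] E]]] := fn x.
rewrite exprS -scalerA E scalerDr; apply: submodD => //; first exact: submodZ.
by rewrite scalerA mulrC -scalerA; apply: submodZ => //; apply/PE/Pf/mem_head.
Qed.

(** Otherwise some element outside [q] lies in all the [P], and a power of it
    kills [M / K]. *)
Lemma prime_filtration_meet K Ps q : prime_filtration K Ps ->
  colon K `<=` q -> exists2 P, P \in Ps & spec_set P `<=` q.
Proof.
move=> fK Kq; have [f [qf fP]] := separate Ps q.
apply: contrapT => nP; have [|n fn] := @prime_filtration_power _ _ f fK.
  by move=> P PPs; have [//|Pq] := fP P PPs; case: nP; exists P.
by apply: qf; apply: primeX; apply: Kq fn.
Qed.

(** A multiple of the element annihilated by [Q] either falls into the bottom copy
    of [A / P], where every nonzero element has annihilator [P], or it survives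
    above it. *)
Lemma prime_filtration_associated K Ps Q : prime_filtration K Ps ->
  associated K Q -> Q \in Ps.
Proof.
elim=> {K Ps} [[x xE]|K y P Ps sK PE _ IH [x xE]].
  by case: (@prime1 _ Q); apply/xE.
rewrite inE; have [[a [nKa [k [_ [Kk [b ->] axE]]]]]|nex] :=
  pselect (exists a, ~ K (a *: x) /\ addm K (cycm y) (a *: x)).
  apply/orP; left; apply/eqP.
  have Pb : ~ spec_set P b.
    by move=> /PE Kb; apply: nKa; rewrite axE; apply: submodD.
  have Qa : ~ spec_set Q a by move=> /xE.
  have key c : K ((c * a) *: x) <-> K ((c * b) *: y).
    rewrite -!scalerA axE scalerDr; split=> h.
      rewrite -[X in K X](addKr (c *: k)); apply: submodD => //.
      exact/(submodN sK)/(submodZ c sK).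
    by apply: submodD => //; apply: submodZ.
  apply: spec_antisym => c.
    by move=> /(prime_mulr a) /xE /key /PE /primeM[].
  by move=> /(prime_mulr b) /PE /key /xE /primeM[].
apply/orP; right; apply: IH; exists x => a; rewrite xE; split=> [Ka|Ka].
  exact: (subset_addl (submod_cyc y)).
by apply: contrapT => nKa; apply: nex; exists a.
Qed.

End PrimeFiltrations.

Lemma ideal_colon (A : comNzRingType) (I : set A) :
  submodule (M := A^o) I -> colon (M := A^o) I = I.
Proof.
move=> sI; apply/seteqP; split=> a; first by move/(_ 1); rewrite /GRing.scale /= mulr1.
by move=> Ia b; rewrite /GRing.scale /= mulrC; apply: (submodZ (M := A^o)).
Qed.

Lemma minimal_prime_list (A : comNzRingType) (I : set A) :
  noetherian_module A^o -> submodule (M := A^o) I ->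
  exists Ps : seq (Spec A), (forall P, P \in Ps -> I `<=` P) /\
    (forall q, I `<=` spec_set q -> exists2 P, P \in Ps & spec_set P `<=` q).
Proof.
move=> nA sI; have [Ps fPs] := prime_filtration_exists nA nA sI.
exists Ps; split=> [P|q]; rewrite -{1}(ideal_colon sI).
  exact: prime_filtration_colon.
exact: prime_filtration_meet.
Qed.

Lemma minimal_prime_below (A : comNzRingType) (I : set A) q :
  noetherian_module A^o -> submodule (M := A^o) I -> I `<=` spec_set q ->
  exists2 P, spec_set P `<=` q & minimal_over P I.
Proof.
move=> nA sI Iq; have [Ps [PsI Psq]] := minimal_prime_list nA sI.
have [P [PPs Pq Pmin]] := minimal_in_list (Psq q Iq).
exists P => //; split=> [|Q IQ QP]; first exact: PsI.
have [P' P'Ps P'Q] := Psq Q IQ.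
by apply: spec_antisym => //; rewrite -(Pmin P') //; apply: subset_trans QP.
Qed.

Section Regular.
Variables (A : comNzRingType) (M : lmodType A).
Hypotheses (nA : noetherian_module A^o) (nM : noetherian_module M).
Implicit Types (p q P Q : Spec A) (K L : set M) (x y : M) (a b z : A).

(** [z] is a nonzerodivisor on the localization of [M / K] at [q]. *)
Definition regular_at q K z : Prop := forall x, sat q K (z *: x) -> sat q K x.

Lemma regular_atW p q K z : submodule K ->
  spec_set q `<=` p -> regular_at p K z -> regular_at q K z.
Proof.
move=> sK qp reg x [s qs]; rewrite scalerA mulrC -scalerA => Kx.
by apply: (satZ qs); apply: (satW qp); apply/reg/sat_sub.
Qed.

Lemma associated_sat_sub q K P : associated (sat q K) P -> spec_set P `<=` q.
Proof.
move=> [y yP] a /yP ay; apply: contrapT => qa.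
by case: (@prime1 _ P); apply/yP; rewrite scale1r; apply: satZ ay.
Qed.

Lemma associated_sat_colon q K P : associated (sat q K) P -> colon K `<=` P.
Proof. by move=> [y yP] a Ka; apply/yP/sat_sub. Qed.

Lemma zerodivisor_associated q K z : submodule K -> ~ regular_at q K z ->
  exists2 P, associated (sat q K) P & spec_set P z.
Proof.
move=> sK /existsNP[x /not_implyP[zx nx]].
have sqK := submod_sat q sK.
have [P [a Pax]] := associated_exists nA sqK nx.
exists P; first by exists (a *: x).
by apply/Pax; rewrite scalerA mulrC -scalerA; apply: submodZ.
Qed.

(** The zerodivisors form the union of the finitely many associated primes, so
    prime avoidance applies to an ideal of zerodivisors. Two modules are treated
    at once for the sake of [CM_at_quotient]. *)
Lemma no_common_regular q K L (I : set A) : submodule K -> submodule L ->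
  submodule (M := A^o) I ->
  (forall z, I z -> regular_at q K z -> ~ regular_at q L z) ->
  exists2 P, associated (sat q K) P \/ associated (sat q L) P & I `<=` P.
Proof.
move=> sK sL sI nreg.
have [Ks fK] := prime_filtration_exists nA nM (submod_sat q sK).
have [Ls fL] := prime_filtration_exists nA nM (submod_sat q sL).
pose isass P := `[< associated (sat q K) P \/ associated (sat q L) P >].
have [|P] := @prime_avoidance _ [seq P <- Ks ++ Ls | isass P] I sI; last first.
  by rewrite mem_filter => /andP[/asboolP assP _] IP; exists P.
move=> z Iz.
have [rK|/(zerodivisor_associated sK)[P assP Pz]] := pselect (regular_at q K z).
  have /(zerodivisor_associated sL)[P assP Pz] := nreg z Iz rK.
  exists P => //; rewrite mem_filter mem_cat.
  rewrite (prime_filtration_associated fL assP) orbT andbT.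
  by apply/asboolP; right.
exists P => //; rewrite mem_filter mem_cat.
rewrite (prime_filtration_associated fK assP) andbT.
by apply/asboolP; left.
Qed.

(** Depth zero at [q]: the residue field of [q] embeds into [M / K] at [q]. *)
Definition socle_at q K : Prop :=
  exists2 u, ~ sat q K u & forall a, spec_set q a -> sat q K (a *: u).

Lemma associated_socle q K : associated (sat q K) q -> socle_at q K.
Proof.
move=> [y yq]; exists y => [ny|a]; last by move/yq.
by apply: (@prime1 _ q); apply/yq; rewrite scale1r.
Qed.

Lemma common_regular q K L : submodule K -> submodule L ->
  ~ socle_at q K -> ~ socle_at q L ->
  exists z, [/\ spec_set q z, regular_at q K z & regular_at q L z].
Proof.
move=> sK sL nK nL; apply: contrapT => /forallNP nreg.
have [||P assP qP] := @no_common_regular q K L q sK sL.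
- exact: submod_prime.
- by move=> z qz rK rL; apply: (nreg z).
have Pq : spec_set P `<=` q by case: assP => /associated_sat_sub.
have Eq : P = q by apply: spec_antisym.
by move: assP; rewrite Eq => -[] /associated_socle.
Qed.

Lemma regular_socle q K z : spec_set q z -> regular_at q K z -> ~ socle_at q K.
Proof. by move=> qz rz [u nu qu]; apply/nu/rz/qu. Qed.

(** Every prime [q] of the support contains an associated prime, which consists
    of zerodivisors and so differs from [q] if [z] is in [q]. *)
Lemma regular_not_minimal p q K z : submodule K -> spec_set q `<=` p ->
  colon K `<=` q -> spec_set q z -> regular_at p K z ->
  exists P, [/\ colon K `<=` P, spec_set P `<=` q & P <> q].
Proof.
move=> sK qp Kq qz /(regular_atW sK qp) reg.
have [x nx] := (colon_supp q nM sK).1 Kq.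
have [P [a Pax]] := associated_exists nA (submod_sat q sK) nx.
have assP : associated (sat q K) P by exists (a *: x).
exists P; split; [exact: associated_sat_colon assP|exact: associated_sat_sub assP|].
move=> Pq; have /Pax/reg axq : spec_set P z by rewrite Pq.
by apply: (@prime1 _ P); apply/Pax; rewrite scale1r.
Qed.

(** Were the quotient by [z] zero at [P], then so would be [M / K] itself, by
    Nakayama's lemma. *)
Lemma colon_mul P K z : submodule K -> colon K `<=` P -> spec_set P z ->
  colon (addm K (mulm z)) `<=` P.
Proof.
move=> sK KP Pz; have sz := submod_mul M z.
apply/(colon_supp P nM (submod_add sK sz)); apply: contrapT => /forallNP all.
have [x nx] := (colon_supp P nM sK).1 KP; apply: nx.
suff /(_ x Logic.I) : setT `<=` sat P K by [].
apply: nakayama => // N sN KN pN NP w _.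
apply: pN; apply: satS (contrapT (all w)).
by apply: addm_sub => // _ [v ->]; apply: NP.
Qed.

Lemma colon_mul_mem K z : submodule K -> colon (addm K (mulm z)) z.
Proof. by move=> sK x; apply: subset_addr => //; exists x. Qed.

Lemma colon_mul_sub K z : colon K `<=` colon (addm K (mulm z)).
Proof. by apply: colonS; apply: subset_addl; apply: submod_mul. Qed.

End Regular.

(** * Filtrations by copies of a cyclic module *)

Section Filtered.
Variables (A : comNzRingType) (M : lmodType A).
Implicit Types (p q P : Spec A) (I : set A) (K : set M) (x y : M) (a b z : A).

(** Locally at [q], [M / K] has a filtration with [n] steps isomorphic to [A / I],
    read from the bottom up. The steps that vanish at [q] are kept as separate
    [filtered_skip] steps, so that a prime filtration can be used as it is. *)
Inductive filtered q I : nat -> set M -> Prop :=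
| filtered_all K : (forall x, sat q K x) -> filtered q I 0 K
| filtered_step n K y : submodule K ->
    (forall a, sat q K (a *: y) <-> sat (M := A^o) q I a) ->
    filtered q I n (addm K (cycm y)) -> filtered q I n.+1 K
| filtered_skip n K y : submodule K -> sat q K y ->
    filtered q I n (addm K (cycm y)) -> filtered q I n K.

Lemma addm_cyc_sat q K y : submodule K -> sat q K y ->
  addm K (cycm y) `<=` sat q K.
Proof.
move=> sK Ky; have sqK := submod_sat q sK.
by apply: addm_sub => //; [exact: sat_sub|move=> _ [a ->]; apply: submodZ].
Qed.

(** Regularity passes to extensions of modules, hence from [A / I] to
    [M / K]. *)
Lemma filtered_regular q I n K z : filtered q I n K ->
  regular_at (M := A^o) q I z -> regular_at q K z.
Proof.
move=> fK rz; elim: fK => {n K} [K allK x _ //|n K y sK yI _ IH x|n K y sK Ky _ IH x] zx.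
  have sqK := submod_sat q sK.
  have sub : sat q K `<=` sat q (addm K (cycm y)) by apply/satS/subset_addl/submod_cyc.
  have [s qs [k [_ [Kk [b ->] sx]]]] := IH _ (sub _ zx).
  apply: (satZ qs); rewrite sx; apply: (submodD sqK); first exact: sat_sub.
  apply/yI/rz/yI; rewrite [z *: _]/(z * b).
  have -> : (z * b) *: y = s *: (z *: x) - z *: k.
    rewrite (scalerA s) (mulrC s) -(scalerA z s) sx scalerDr scalerA.
    by rewrite addrAC subrr add0r.
  by apply: submodB => //; [exact: submodZ|exact/(submodZ z sqK)/sat_sub].
have sub := @addm_cyc_sat q K y sK Ky.
apply: (sat_trans sub); apply: IH; apply: satS zx.
exact/subset_addl/submod_cyc.
Qed.

(** Dividing by an element regular on [A / I] keeps all the short exact sequences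
    of the filtration exact. *)
Lemma filtered_mul q I n K z : submodule (M := A^o) I -> filtered q I n K ->
  regular_at (M := A^o) q I z ->
  filtered q (addm (M := A^o) I (mulm (M := A^o) z)) n (addm K (mulm z)).
Proof.
move=> sI fK rz; have sz := submod_mul M z.
elim: fK => {n K} [K allK|n K y sK yI fK IH|n K y sK Ky _ IH].
- apply: filtered_all => x; apply: satS (allK x); exact: subset_addl.
- apply: (@filtered_step q _ n _ y).
  + exact: submod_add.
  + move=> a; split.
      move=> [s qs [k [_ [Kk [w ->] E]]]].
      have [t qt [k' [_ [Kk' [b ->] tw]]]] : sat q (addm K (cycm y)) w.
        apply: (filtered_regular fK rz); apply: sat_sub.
        have -> : z *: w = - k + (s * a) *: y by rewrite -scalerA E addKr.
        by exists (- k), ((s * a) *: y); split; [exact: submodN|exists (s * a)|].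
      have [r qr Ir] : sat (M := A^o) q I (t * s * a - z * b).
        apply/yI; apply: sat_sub.
        have -> : (t * s * a - z * b) *: y = t *: k + z *: k'.
          rewrite scalerBl -!scalerA E scalerDr (scalerA t z) (mulrC t) -(scalerA z t) tw.
          by rewrite scalerDr addrA addrK.
        by apply: submodD => //; apply: submodZ.
      exists (r * (t * s)); first by do 2?apply: nprimeM.
      exists (r * (t * s * a - z * b)), (z * (r * b)).
      split=> //; first by exists (r * b).
      by rewrite /GRing.scale /=; ring.
    move=> [r qr [i [_ [Ii [b ->] E]]]]; apply: (satZ qr).
    rewrite scalerA -[r * a]/(r *: (a : A^o)) E scalerDl.
    have sqK : submodule (sat q (addm K (mulm z))) by apply/submod_sat/submod_add.
    apply: submodD => //.
      have : sat q K (i *: y) by apply/yI/sat_sub.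
      exact/satS/subset_addl.
    apply: sat_sub; apply: subset_addr => //; exists (b *: y).
    by rewrite scalerA.
  + by rewrite addmAC.
- apply: (@filtered_skip q _ n _ y); first exact: submod_add.
    by apply: satS Ky; apply: subset_addl.
  by rewrite addmAC.
Qed.

(** The bottom copy of [A / I] is a submodule of [M / K]. *)
Lemma filtered_socle q I n K : filtered q I n.+1 K ->
  socle_at (M := A^o) q I -> socle_at q K.
Proof.
move En: n.+1 => m fK [u nu qu].
elim: fK n En => {m K} [//|m K y sK yI _ _ n _|m K y sK Ky _ IH n En].
  by exists (u *: y) => [/yI//|a qa]; rewrite scalerA; apply/yI/qu.
have [v nv qv] := IH n En.
have sub : sat q (addm K (cycm y)) `<=` sat q K by apply/sat_trans/addm_cyc_sat.
exists v => [Kv|a qa]; last by apply/sub/qv.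
by apply: nv; apply: satS Kv; apply/subset_addl/submod_cyc.
Qed.

Lemma filtered_colon q I n K :
  filtered q I n.+1 K -> colon K `<=` sat (M := A^o) q I.
Proof.
move En: n.+1 => m fK.
elim: fK n En => {m K} [//|m K y sK yI _ _ n _ a Ka|m K y sK Ky _ IH n En].
  exact/yI/sat_sub.
by apply: subset_trans (IH n En); apply: colonS; apply/subset_addl/submod_cyc.
Qed.

(** A power of [I] kills [M / K] at [q]. *)
Lemma filtered_prime q I n K P : noetherian_module M -> submodule K ->
  filtered q I n K -> spec_set P `<=` q -> colon K `<=` P -> I `<=` P.
Proof.
move=> nM sK fK Pq /(colon_supp P nM sK)[x nx] b Ib; apply: contrapT => Pb; apply: nx.
suff [k /(satW Pq)] : exists k, sat q K (b ^+ k *: x).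
  by apply: satZ => /primeX.
move: fK; elim => {n K sK} [K allK|n K y sK yI _ [k]|n K y sK Ky _ [k kx]].
- by exists 0%N.
- have sqK := submod_sat q sK.
  move=> [s qs [l [_ [Kl [c ->] E]]]]; exists k.+1; apply: (satZ qs).
  have -> : s *: (b ^+ k.+1 *: x) = b *: l + c *: (b *: y).
    by rewrite exprS -(scalerA b) scalerA mulrC -scalerA E scalerDr !scalerA (mulrC b).
  apply: submodD => //; first exact/sat_sub/(submodZ b sK).
  exact/(submodZ c sqK)/yI/sat_sub.
- by exists k; apply: sat_trans kx; apply: addm_cyc_sat.
Qed.

(** The descending chain condition for modules of finite length, here for
    submodules containing [K] and up to localization at [P]. *)
Lemma filtered_descending P n K (J : nat -> set M) :
  filtered P (spec_set P) n K -> (forall k, submodule (J k)) ->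
  (forall k, K `<=` J k) -> (forall k, J k.+1 `<=` J k) ->
  exists N, forall k, (N <= k)%N -> J k `<=` sat P (J k.+1).
Proof.
move=> fK; elim: fK J => {n K} [K allK|n K y sK yI _ IH|n K y sK Ky _ IH] J sJ KJ decr.
- by exists 0%N => k _ x _; apply: satS (allK x); apply: KJ.
- have mono k l : (k <= l)%N -> J l `<=` J k.
    by move=> /subnK <-; elim: (_ - _)%N => [//|i Hi] x /decr/Hi.
  have sC := submod_cyc y.
  have [|k|k|N HN] := IH (fun k => addm (J k) (cycm y)).
  + by move=> k; apply: submod_add.
  + apply: addm_sub; [exact: submod_add| |exact: subset_addr].
    by apply: subset_trans (subset_addl _); first exact: KJ.
  + apply: addm_sub; [exact: submod_add| |exact: subset_addr].
    by apply: subset_trans (subset_addl _); first exact: decr.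
  have [all|/existsNP[m nm]] := pselect (forall k, sat P (J k) y).
    exists N => k Nk x /(subset_addl sC)/(HN k Nk).
    by apply: sat_trans; apply: addm_cyc_sat.
  exists (maxn N m) => k; rewrite geq_max => /andP[Nk mk] x Jx.
  have [s Ps [j [_ [Jj [b ->] E]]]] := HN k Nk x (subset_addl sC Jx).
  apply: (satZ Ps); rewrite E; apply: submodD; [exact: submod_sat|exact: sat_sub|].
  have Jby : J k (b *: y).
    have -> : b *: y = s *: x - j by rewrite E addrC addKr.
    by apply: submodB => //; [exact: submodZ|exact: decr].
  have Pb : spec_set P b.
    by apply: contrapT => Pb; apply: nm; exists b => //; apply: (mono m k).
  have : sat P K (b *: y) by apply/yI/sat_sub.
  exact: satS.
- have sC := submod_cyc y.
  have [|k|k|N HN] := IH (fun k => addm (J k) (cycm y)).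
  + by move=> k; apply: submod_add.
  + apply: addm_sub; [exact: submod_add| |exact: subset_addr].
    by apply: subset_trans (subset_addl _); first exact: KJ.
  + apply: addm_sub; [exact: submod_add| |exact: subset_addr].
    by apply: subset_trans (subset_addl _); first exact: decr.
  exists N => k Nk x /(subset_addl sC)/(HN k Nk).
  apply: sat_trans; apply: addm_cyc_sat => //.
  by apply: satS Ky; apply: KJ.
Qed.

(** The primes of a prime filtration other than the minimal prime [p] are not
    contained in [p], so some [f] outside [p] kills their steps. *)
Lemma minimal_filtered p K : noetherian_module A^o -> noetherian_module M ->
  submodule K -> minimal_over p (colon K) ->
  exists2 f, ~ spec_set p f & forall q, spec_set p `<=` q -> ~ spec_set q f ->
    exists n, filtered q (spec_set p) n.+1 K.
Proof.
move=> nA nM sK [Kp pmin]; have [Ps fK] := prime_filtration_exists nA nM sK.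
have [f [pf fP]] := separate Ps p.
have fP' P : P \in Ps -> P = p \/ spec_set P f.
  move=> PPs; have [|Pp] := fP P PPs; [by right|left].
  by apply: pmin => //; apply: (prime_filtration_colon fK).
exists f => // q pq qf.
suff [n fn] : exists n, filtered q (spec_set p) n K.
  case: n fn => [|n] fn; last by exists n.
  have [x nx] := (colon_supp p nM sK).1 Kp; case: nx; apply: (satW pq).
  move En: 0%N fn => m fn.
  elim: fn En => [L allL _|//|? L y sL Ly _ IH En]; first exact: allL.
  by apply: sat_trans (IH En); apply: addm_cyc_sat.
elim: fK fP' {Kp pmin fP} => {K sK} [|K y P {}Ps sK PE _ IH] fP.
  by exists 0%N; apply: filtered_all => x; apply: sat_sub.
have [|n fn] := IH; first by move=> Q QPs; apply: fP; rewrite inE QPs orbT.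
have [Pp|Pf] := fP P (mem_head _ _).
  exists n.+1; apply: filtered_step fn => // a; rewrite -Pp; split=> -[s qs].
    by rewrite scalerA => /PE h; exists s.
  by move=> h; exists s => //; rewrite scalerA; apply/PE.
by exists n; apply: filtered_skip fn => //; exists f => //; apply/PE.
Qed.

End Filtered.

(** * Krull's principal ideal theorem *)

Section Krull.
Variable A : comNzRingType.
Hypothesis nA : noetherian_module A^o.
Implicit Types (p q P Q : Spec A) (I L : set A^o).

(* The product of two ideals, as the smallest submodule containing the products
   of their elements: the form in which [nakayama] takes it. *)
Let product I L : set A^o := [set x | forall N : set A^o, submodule N ->
  (forall a b : A, I a -> L b -> N (a * b)) -> N x].

Let submod_product I L : submodule (product I L).
Proof.
split=> [N sN _|a x y Ix Iy N sN IL]; first exact: submod0.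
by apply: sN.2; [exact: Ix|exact: Iy].
Qed.

(** The preimage in [A] of a symbolic power of [Q1 / Q]. *)
Fixpoint symbolic_power Q Q1 n : set A^o :=
  if n is n'.+1 then
    sat Q1 (addm (M := A^o) (spec_set Q) (product (spec_set Q1) (symbolic_power Q Q1 n')))
  else setT.

Section SymbolicPower.
Variables (Q Q1 : Spec A).
Let S := symbolic_power Q Q1.

Lemma submod_symbolic_power n : submodule (S n).
Proof.
case: n => [|n]; first exact: submodT.
by apply/submod_sat/submod_add; [exact: submod_prime|exact: submod_product].
Qed.

Lemma symbolic_power_base n : spec_set Q `<=` S n.
Proof.
by case: n => [|n] // x Qx; apply: sat_sub; apply: subset_addl.
Qed.

Lemma symbolic_power_sat n : sat Q1 (S n) `<=` S n.
Proof. by case: n => [|n] //; apply: sat_idem. Qed.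

Lemma symbolic_power_decr n : S n.+1 `<=` S n.
Proof.
elim: n => [//|n IH]; apply: satS; apply: addm_sub.
- by apply: submod_add; [exact: submod_prime|exact: submod_product].
- exact: subset_addl.
- apply: subset_trans (subset_addr _); last exact: submod_prime.
  by move=> x Sx N sN IL; apply: Sx => // a b Qa Sb; apply: IL => //; apply: IH.
Qed.

Lemma mem_symbolic_power y n : spec_set Q1 y -> S n (y ^+ n).
Proof.
move=> Q1y; elim: n => [//|n IH]; rewrite exprS; apply: sat_sub.
apply: subset_addr; first exact: submod_prime.
by move=> N sN; apply.
Qed.

End SymbolicPower.

(** Modulo [Q + (x)] the ring has finite length at [P], so the symbolic powers
    of [Q1] are eventually constant modulo [x]. Since [x] is not in [Q1],
    Nakayama's lemma at [P] makes them constant, and at [Q1] makes them vanish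
    modulo [Q]. *)
Theorem krull_principal_ideal Q Q1 P x :
  spec_set Q `<=` Q1 -> spec_set Q1 `<=` P ->
  minimal_over P (addm (spec_set Q : set A^o) (mulm (x : A^o))) ->
  Q = Q1 \/ Q1 = P.
Proof.
move=> QQ1 Q1P minP; set K := addm _ _ in minP.
have sQ := submod_prime Q.
have sK : submodule K by apply: submod_add => //; apply: submod_mul.
apply: contrapT => /not_orP[QnQ1 Q1nP].
have Q1x : ~ spec_set Q1 x.
  move=> Q1x; apply: Q1nP; apply: minP.2 => //.
  apply: (@addm_sub A A^o) => //; first exact: submod_prime.
  by move=> _ [c ->]; apply: prime_mulr.
pose S := symbolic_power Q Q1.
have sS n : submodule (S n) by apply: submod_symbolic_power.
have [n Sn] : exists n, S n `<=` S n.+1.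
  have [|f Pf fP] := minimal_filtered (K := K) nA nA sK (p := P).
    by rewrite ideal_colon.
  have [l fK] := fP P (@subset_refl _ _) Pf.
  have [|k|k|n /(_ n (leqnn n)) Jn] :=
    filtered_descending (J := fun k => addm (S k) K) fK.
  - by move=> k; apply: submod_add.
  - exact: subset_addr.
  - apply: addm_sub; [exact: submod_add| |exact: subset_addr].
    by apply: subset_trans (subset_addl _) => //; apply: symbolic_power_decr.
  exists n; apply: subset_trans (@symbolic_power_sat Q Q1 n.+1).
  apply: subset_trans (satW Q1P); apply: nakayama => // N sN SN PN NP a Sa.
  have [s Ps [b [_ [Sb [q [_ [Qq [c ->] ->]]] E]]]] := Jn a (subset_addl sK Sa).
  have Sc : S n c.
    apply: symbolic_power_sat; exists x => //.
    have -> : x *: c = s *: a - b - q by rewrite E (addrC b) addrK (addrC q) addrK.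
    apply: submodB => //; last exact: symbolic_power_base.
    by apply: submodB => //; [exact: submodZ|exact: symbolic_power_decr].
  apply: PN; exists s => //; rewrite E; apply: submodD => //; first exact: SN.
  apply: submodD => //; first exact/SN/symbolic_power_base.
  apply: NP => //; apply: minP.1; apply: subset_addr => //; exists (1 : A^o).
  by rewrite /GRing.scale /= mulr1.
have SQ : S n `<=` sat (M := A^o) Q1 Q.
  apply: nakayama => // N sN QN Q1N NQ1.
  apply: (subset_trans Sn); apply: subset_trans Q1N.
  by apply: satS; apply: addm_sub => // b; apply.
have [y /not_implyP[Q1y Qy]] : exists y, ~ (spec_set Q1 y -> spec_set Q y).
  by apply/existsNP => Q1Q; apply: QnQ1; apply: spec_antisym.
have [s Q1s] := SQ _ (mem_symbolic_power Q n Q1y).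
by move=> /primeM[/QQ1 //|/primeX].
Qed.

Corollary krull_no_intermediate Q Q1 P x :
  spec_set Q `<=` Q1 -> spec_set Q1 `<=` P -> spec_set P x ->
  (forall q, spec_set Q `<=` q -> spec_set q x -> spec_set q `<=` P -> q = P) ->
  Q = Q1 \/ Q1 = P.
Proof.
move=> QQ1 Q1P Px Pmin; apply: (krull_principal_ideal (x := x) QQ1 Q1P).
split=> [|q Qxq qP].
  apply: (@addm_sub A A^o); [exact: submod_prime|exact: subset_trans Q1P|].
  by move=> _ [c ->]; apply: prime_mulr.
apply: Pmin => //.
  by apply: subset_trans Qxq; apply: (subset_addl (M := A^o)); apply: submod_mul.
apply: Qxq; apply: (subset_addr (M := A^o)); first exact: submod_prime.
by exists (1 : A^o); rewrite /GRing.scale /= mulr1.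
Qed.

End Krull.

(** * Cohen-Macaulay quotients at a prime *)

Section CohenMacaulayAt.
Variables (A : comNzRingType) (M : lmodType A).
Hypotheses (nA : noetherian_module A^o) (nM : noetherian_module M).
Implicit Types (p q P Q : Spec A) (K L : set M) (x y z : A).

(** For a finite module this means that [M / K] is nonzero at [q] with depth and
    dimension both equal to [d]. A single sequence that is at once regular and a
    system of parameters witnesses it, which spares the comparison of depth with
    dimension until [cohen_macaulay_locE]. *)
Fixpoint CM_at q K d : Prop :=
  if d is d'.+1 then
    exists z, [/\ spec_set q z, regular_at q K z & CM_at q (addm K (mulm z)) d']
  else minimal_over q (colon K).

Lemma minimal_over_no_regular q K z : submodule K ->
  minimal_over q (colon K) -> spec_set q z -> ~ regular_at q K z.
Proof.
move=> sK [Kq qmin] qz rz.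
have [P [KP Pq nPq]] := regular_not_minimal nA nM sK (@subset_refl _ _) Kq qz rz.
by apply/nPq/qmin.
Qed.

(** A relation [x u = z v] modulo [K] forces [v] into [K + xM], because [z]
    is regular modulo [K + xM]; then [x] cancels. *)
Lemma regular_at_comm q K x z : submodule K -> regular_at q K x ->
  regular_at q (addm K (mulm x)) z -> regular_at q (addm K (mulm z)) x.
Proof.
move=> sK rx rz u [s qs [k [_ [Kk [v ->] E]]]].
have sx := submod_mul M x; have sz := submod_mul M z.
have [t qt [k' [_ [Kk' [w ->] E']]]] : sat q (addm K (mulm x)) v.
  apply/rz/sat_sub; exists (- k), (x *: (s *: u)); split; first exact: submodN.
    by exists (s *: u).
  by rewrite scalerA (mulrC x) -scalerA E addKr.
have sL : submodule (sat q (addm K (mulm z))) by apply/submod_sat/submod_add.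
apply: (satZ (nprimeM qt qs)); rewrite -[X in sat _ _ X](subrK (z *: w)).
apply: submodD => //; last by apply/sat_sub/subset_addr => //; exists w.
apply: (satS (subset_addl sz)); apply/rx/sat_sub.
have -> : x *: ((t * s) *: u - z *: w) = t *: k + z *: k'.
  rewrite scalerBr (scalerA x) (mulrC x) -!scalerA E scalerDr.
  rewrite (scalerA t z) (mulrC t) -(scalerA z t) E' scalerDr addrA.
  by rewrite !(scalerA _ _ w) (mulrC x) addrK.
by apply: submodD => //; apply: submodZ.
Qed.

(** Put [N = M / K]. If [u] is killed by [q] modulo [yN], write [x u = y v]; then
    [v] is killed by [q] modulo [xN], and [v] in [xN] would put [u] in [yN]. (Both
    socles are the first [Ext] module of the residue field with values in
    [N].) *)
Lemma socle_swap q K x y : submodule K -> spec_set q x ->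
  regular_at q K x -> regular_at q K y ->
  socle_at q (addm K (mulm y)) -> socle_at q (addm K (mulm x)).
Proof.
move=> sK qx rx ry [u nu qu].
have sx := submod_mul M x; have sy := submod_mul M y.
have sqK := submod_sat q sK.
have sLx : submodule (sat q (addm K (mulm x))) by apply/submod_sat/submod_add.
have sLy : submodule (sat q (addm K (mulm y))) by apply/submod_sat/submod_add.
have KLx : sat q K `<=` sat q (addm K (mulm x)) by apply/satS/subset_addl.
have KLy : sat q K `<=` sat q (addm K (mulm y)) by apply/satS/subset_addl.
have xLx w : sat q (addm K (mulm x)) (x *: w).
  by apply/sat_sub/subset_addr => //; exists w.
have yLy w : sat q (addm K (mulm y)) (y *: w).
  by apply/sat_sub/subset_addr => //; exists w.
have [s qs [k [_ [Kk [v ->] E]]]] := qu x qx.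
exists v => [[t qt [k' [_ [Kk' [w ->] E']]]]|a qa].
  apply: nu; apply: (satZ (nprimeM qt qs)).
  rewrite -[X in sat _ _ X](subrK (y *: w)); apply: submodD => //.
  apply/KLy/rx/sat_sub.
  have -> : x *: ((t * s) *: u - y *: w) = t *: k + y *: k'.
    rewrite scalerBr (scalerA x) (mulrC x) -!scalerA E scalerDr.
    rewrite (scalerA t y) (mulrC t) -(scalerA y t) E' scalerDr addrA.
    by rewrite !(scalerA _ _ w) (mulrC x) addrK.
  by apply: submodD => //; apply: submodZ.
have [r qr [k' [_ [Kk' [w ->] E']]]] := qu a qa.
apply: (satZ qr); rewrite -[X in sat _ _ X](subrK (x *: (s *: w))).
apply: submodD => //; apply/KLx/ry/sat_sub.
have -> : y *: (r *: (a *: v) - x *: (s *: w)) = (s * x) *: k' - (r * a) *: k.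
  have yv : y *: v = s *: (x *: u) - k by rewrite E addrC addKr.
  have -> : y *: (r *: (a *: v) - x *: (s *: w)) =
            (r * a) *: (y *: v) - (s * x) *: (y *: w).
    by rewrite scalerBr !scalerA; congr (_ *: _ - _ *: _); ring.
  have -> : (s * x) *: (y *: w) = (r * a) *: (s *: (x *: u)) - (s * x) *: k'.
    have -> : y *: w = r *: (a *: u) - k' by rewrite E' addrC addKr.
    by rewrite scalerBr !scalerA; congr (_ *: _ - _); ring.
  by rewrite yv scalerBr opprB addrC addrA subrK.
by apply: submodB => //; apply: submodZ.
Qed.

(** The given sequence starts with some [x], and [y] need not be regular on
    [M / (K + xM)]; by [socle_swap] there is an element [z] regular on both
    [M / (K + xM)] and [M / (K + yM)], through which [x] and [y] are exchanged
    one after the other. When [M / (K + xM)] has finite length already, so does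
    [M / (K + yM)], by Krull's theorem. *)
Lemma CM_at_quotient q K d y : submodule K -> CM_at q K d ->
  spec_set q y -> regular_at q K y ->
  exists2 d', d = d'.+1 & CM_at q (addm K (mulm y)) d'.
Proof.
move=> sK cm qy ry; have sm z := submod_mul M z.
case: d cm => [/minimal_over_no_regular - /(_ y sK qy) //|d cm]; exists d => //.
elim: d K y sK cm qy ry => [|d IH] K y sK [x [qx rx cm]] qy ry.
  have sKx := submod_add sK (sm x); have sKy := submod_add sK (sm y).
  have [Kxq qmin] := cm.
  have Kq : colon K `<=` q by apply: subset_trans Kxq; apply: colon_mul_sub.
  split=> [|Q KyQ Qq]; first exact: colon_mul.
  have KQ : colon K `<=` Q by apply: subset_trans KyQ; apply: colon_mul_sub.
  have Qy : spec_set Q y by apply: KyQ; apply: colon_mul_mem.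
  have [P [KP PQ PnQ]] := regular_not_minimal nA nM sK Qq KQ Qy ry.
  have [Q' PQ' Q'y Q'q|PQ0|//] := krull_no_intermediate nA (x := x) PQ Qq qx.
    apply: qmin => //; apply: colon_mul => //; exact: subset_trans KP PQ'.
  by case: PnQ.
have sKx := submod_add sK (sm x); have sKy := submod_add sK (sm y).
have nsx : ~ socle_at q (addm K (mulm x)).
  by have [x' [qx' rx' _]] := cm; apply: regular_socle rx'.
have nsy : ~ socle_at q (addm K (mulm y)) by move=> /(socle_swap sK qx rx ry).
have [z [qz rxz ryz]] := common_regular nA nM sKx sKy nsx nsy.
have sKz := submod_add sK (sm z).
exists z; split=> //.
have cmxz := IH _ _ sKx cm qz rxz.
have cmz : CM_at q (addm K (mulm z)) d.+1.
  by exists x; split=> //; [exact: regular_at_comm|rewrite addmAC].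
by rewrite addmAC; apply: IH => //; apply: regular_at_comm.
Qed.

(** By Nakayama's lemma the elements of [M] killed by [P] modulo [K] are not all
    in [K + xM]. One that is not has a multiple with prime annihilator modulo
    [K + xM], and that prime contains [P] and [x]. *)
Lemma associated_quotient p K x P : submodule K -> spec_set p x ->
  regular_at p K x -> associated (sat p K) P ->
  exists P1, [/\ associated (sat p (addm K (mulm x))) P1,
    spec_set P `<=` P1 & spec_set P1 x].
Proof.
move=> sK px rx assP; have sx := submod_mul M x.
have sKx := submod_add sK sx; have spK := submod_sat p sK.
have spKx := submod_sat p sKx.
have [y yP] := assP; have Pp := associated_sat_sub assP.
pose N : set M := [set u | forall a, spec_set P a -> sat p K (a *: u)].
have sN : submodule N.
  split=> [a _|c u v Nu Nv a Pa]; first by rewrite scaler0; apply: submod0.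
  rewrite scalerDr scalerA mulrC -scalerA.
  by apply: spK.2; [exact: Nu|exact: Nv].
have [u /not_implyP[Nu nu]] : exists u, ~ (N u -> sat p (addm K (mulm x)) u).
  apply/existsNP => NKx.
  suff /(_ y (fun a => (yP a).1)) Ky : N `<=` sat p K.
    by apply: (@prime1 _ P); apply/yP; rewrite scale1r.
  apply: nakayama => // N' sN' KN' pN' NP' u Nu.
  have [s ps [k [_ [Kk [w ->] E]]]] := NKx u Nu.
  apply: pN'; exists s => //; rewrite E; apply: submodD => //; first exact: KN'.
  apply: NP' => // a Pa; apply: rx.
  have -> : x *: (a *: w) = s *: (a *: u) - a *: k.
    rewrite (scalerA s) (mulrC s) -(scalerA a s) E scalerDr (addrC (a *: k)) addrK.
    by rewrite !scalerA mulrC.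
  by apply: submodB => //; [exact/(submodZ s spK)/Nu|exact/sat_sub/(submodZ a sK)].
have [P1 [a Pau]] := associated_exists nA spKx nu.
exists P1; split; first by exists (a *: u).
  move=> b Pb; apply/Pau; rewrite scalerA mulrC -scalerA; apply: submodZ => //.
  by apply: satS (Nu b Pb); apply: subset_addl.
by apply/Pau; apply: sat_sub; apply: subset_addr => //; exists (a *: u).
Qed.

(** Unmixedness. Cutting by [x] leads from [P] to an associated prime [P1] of
    the quotient, which by induction is minimal over [P + (x)]; a prime strictly
    below [P] would contradict Krull's theorem. *)
Lemma CM_at_associated p K d P : submodule K -> CM_at p K d ->
  associated (sat p K) P -> minimal_over P (colon K).
Proof.
elim: d K P => [|d IH] K P sK cm assP; have KP := associated_sat_colon assP;
  have Pp := associated_sat_sub assP.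
  split=> // Q KQ QP; have pmin := cm.2.
  by rewrite (pmin P KP Pp) in QP *; apply: pmin.
have [x [px rx cmx]] := cm.
have sx := submod_mul M x; have sKx := submod_add sK sx.
have [P1 [assP1 PP1 P1x]] := associated_quotient sK px rx assP.
have [KxP1 P1min] := IH _ _ sKx cmx assP1.
have nPx : ~ spec_set P x.
  move=> Px; have [y yP] := assP; apply: (@prime1 _ P); apply/yP.
  by rewrite scale1r; apply/rx/yP.
split=> // Q KQ QP.
have [Q' QQ' Q'x Q'P1|//|PeqP1] := krull_no_intermediate nA (x := x) QP PP1 P1x.
  apply: P1min => //; apply: colon_mul => //; exact: subset_trans KQ QQ'.
by case: nPx; rewrite PeqP1.
Qed.

(** Localizing: cut by regular elements taken from [q] as long as there are
    some; at the end [q] lies in an associated prime, which is minimal. *)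
Lemma CM_at_generalize p q K d : submodule K -> CM_at p K d ->
  spec_set q `<=` p -> colon K `<=` q -> exists e, CM_at q K e.
Proof.
elim: d K => [|d IH] K sK cm qp Kq.
  by exists 0%N; rewrite (cm.2 q Kq qp).
have [[z [qz rz]]|nreg] := pselect (exists z, spec_set q z /\ regular_at p K z).
  have sz := submod_mul M z.
  have [_ [<-] cmz] := CM_at_quotient sK cm (qp z qz) rz.
  have [|e cme] := IH _ (submod_add sK sz) cmz qp; first exact: colon_mul.
  by exists e.+1, z; split=> //; apply: regular_atW rz.
have [||P assP qP] := @no_common_regular _ _ nA nM p K K q sK sK.
- exact: submod_prime.
- by move=> z qz rz _; apply: nreg; exists z.
have {}assP : associated (sat p K) P by case: assP.
have [_ Pmin] := CM_at_associated sK cm assP.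
by exists 0%N; rewrite (Pmin q Kq qP); exact: CM_at_associated cm assP.
Qed.

End CohenMacaulayAt.

(** * Chains of primes and regular sequences *)

Section Heights.
Variable A : comNzRingType.
Implicit Types (p P Q : Spec A) (I J : set A).

(** In [A / I] the prime [P] has height at least [n]. Chains are built downwards
    from [P], the direction in which [height_ge_cut] modifies them. *)
Fixpoint height_ge I n P : Prop :=
  if n is n'.+1 then
    exists Q, [/\ spec_set Q `<=` P, Q <> P & height_ge I n' Q]
  else I `<=` P.

Lemma height_ge_sub I n P : height_ge I n P -> I `<=` P.
Proof. by elim: n P => [//|n IH] P /= [Q [QP _ /IH]] IQ; apply: subset_trans QP. Qed.

Lemma height_geW I n P : height_ge I n.+1 P -> height_ge I n P.
Proof.
elim: n P => [|n IH] P; first exact: height_ge_sub.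
by move=> [Q [QP nQP /IH hQ]]; exists Q.
Qed.

(** By Krull's theorem a chain ending in a prime that contains [x] can be moved,
    from the top down, so that its second prime already contains [x]. *)
Lemma height_ge_cut I J n P x : noetherian_module A^o -> spec_set P x ->
  (forall Q, I `<=` Q -> spec_set Q x -> J `<=` Q) ->
  height_ge I n.+1 P -> height_ge J n P.
Proof.
move=> nA Px IJ; elim: n P Px => [|n IH] P Px hP.
  by apply: IJ => //; apply: height_ge_sub hP.
have [P' [P'P nP'P hP']] := hP.
have [P'x|nP'x] := pselect (spec_set P' x).
  by exists P'; split=> //; apply: IH.
have [P2 [P2P' nP2P' hP2]] := hP'.
have P2P : spec_set P2 `<=` P by apply: subset_trans P'P.
pose P2x : set A^o := addm (M := A^o) (spec_set P2) (mulm (M := A^o) x).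
have [||P1 P1P [P2xP1 P1min]] := @minimal_prime_below A P2x P nA.
- by apply: submod_add; [exact: submod_prime|exact: submod_mul].
- apply: (@addm_sub A A^o); [exact: submod_prime|exact: P2P|].
  by move=> _ [c ->]; apply: prime_mulr.
have P2P1 : spec_set P2 `<=` P1.
  by apply: subset_trans P2xP1; apply: (subset_addl (M := A^o)); apply: submod_mul.
have P1x : spec_set P1 x.
  apply: P2xP1; apply: (subset_addr (M := A^o)); first exact: submod_prime.
  by exists (1 : A^o); rewrite /GRing.scale /= mulr1.
exists P1; split=> //; last first.
  apply: IH => //; exists P2; split=> // P2P1E.
  by apply: nP'x; apply: P2P'; rewrite P2P1E.
move=> P1E; case: (@krull_principal_ideal A nA P2 P' P x P2P' P'P) => //.
by rewrite -P1E.
Qed.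

End Heights.

Section RegularSequences.
Variables (A : comNzRingType) (M : lmodType A).
Hypotheses (nA : noetherian_module A^o) (nM : noetherian_module M).
Implicit Types (p q P Q : Spec A) (K L : set M) (x y z : A) (s : seq A).

Fixpoint regular_seq_at p K s : Prop :=
  if s is z :: s' then
    [/\ spec_set p z, regular_at p K z & regular_seq_at p (addm K (mulm z)) s']
  else colon K `<=` p.

(** A regular element lies in no minimal prime of the support, so a chain for
    [M / (K + zM)] extends at the bottom. *)
Lemma height_ge_extend p P K z n : submodule K -> spec_set P `<=` p ->
  regular_at p K z -> height_ge (colon (addm K (mulm z))) n P ->
  height_ge (colon K) n.+1 P.
Proof.
move=> sK Pp rz; elim: n P Pp => [|n IH] P Pp.
  move=> KzP; have KP := subset_trans (@colon_mul_sub _ _ K z) KzP.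
  have Pz := KzP _ (colon_mul_mem z sK).
  by have [Q [KQ QP nQP]] := regular_not_minimal nA nM sK Pp KP Pz rz; exists Q.
move=> [Q [QP nQP hQ]]; exists Q; split=> //.
by apply: IH hQ; apply: subset_trans Pp.
Qed.

Lemma regular_seq_height p K s : submodule K -> regular_seq_at p K s ->
  height_ge (colon K) (size s) p.
Proof.
elim: s K => [//|z s IH] K sK [pz rz /(IH _ (submod_add sK (submod_mul M z)))].
exact: (height_ge_extend sK (@subset_refl _ _) rz).
Qed.

Lemma CM_at_height p K d n : submodule K -> CM_at p K d ->
  height_ge (colon K) n p -> (n <= d)%N.
Proof.
elim: d n K => [|d IH] [|n] K sK //.
  move=> [Kp pmin] [Q [Qp nQp /height_ge_sub KQ]].
  by case: nQp; apply: pmin.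
move=> [z [pz rz cmz]] /(@height_ge_cut _ _ (colon (addm K (mulm z))) _ _ z nA pz).
move=> /(_ (fun Q => colon_mul nM sK)) h; rewrite ltnS.
exact: IH (submod_add sK (submod_mul M z)) cmz h.
Qed.

Lemma CM_at_regular_seq p K d : CM_at p K d ->
  exists2 s, size s = d & regular_seq_at p K s.
Proof.
elim: d K => [|d IH] K; first by move=> [Kp _]; exists [::].
by move=> [z [pz rz /IH[s <- rs]]]; exists (z :: s).
Qed.

Lemma regular_seq_CM_at p K s : submodule K -> regular_seq_at p K s ->
  (forall n, height_ge (colon K) n p -> (n <= size s)%N) -> CM_at p K (size s).
Proof.
elim: s K => [|z s IH] K sK.
  move=> Kp hmax; split=> // Q KQ Qp; apply: contrapT => nQp.
  by suff : (1 <= 0)%N by []; apply: (hmax 1%N); exists Q.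
move=> [pz rz rs] hmax; exists z; split=> //.
have sKz := submod_add sK (submod_mul M z).
apply: IH => // n h; rewrite -ltnS; apply: hmax.
exact: (height_ge_extend sK (@subset_refl _ _) rz h).
Qed.

End RegularSequences.

(** * Openness of the locus *)

Section Transfer.
Variables (A : comNzRingType) (M : lmodType A).
Hypotheses (nA : noetherian_module A^o) (nM : noetherian_module M).
Implicit Types (p q P Q : Spec A) (K L : set M) (x y z : A).

(** A regular sequence for [A / I] is one for [M / K], and the two supports
    agree. *)
Lemma filtered_CM q (I : set A) n K d :
  submodule (M := A^o) I -> submodule K -> filtered q I n.+1 K ->
  CM_at (M := A^o) q I d -> CM_at q K d.
Proof.
elim: d I K => [|d IH] I K sI sK fK.
  move=> [Iq qmin]; rewrite (ideal_colon sI) in Iq qmin.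
  split=> [a /(filtered_colon fK)[s qs /Iq /primeM[]]//|Q KQ Qq].
  by apply: qmin => //; apply: filtered_prime fK Qq KQ.
move=> [z [qz rz cmz]]; exists z; split=> //; first exact: filtered_regular fK rz.
apply: IH cmz; [|exact: submod_add (submod_mul M z)|exact: filtered_mul].
by apply: submod_add => //; apply: submod_mul.
Qed.

(** Conversely, as long as [M / K] has a regular element at [q], its submodule
    [A / I] has no socle, hence a regular element as well; that element is then
    regular on [M / K] too and both modules can be cut by it. *)
Lemma CM_filtered q (I : set A) n K d :
  submodule (M := A^o) I -> submodule K -> filtered q I n.+1 K ->
  CM_at q K d -> CM_at (M := A^o) q I d.
Proof.
elim: d I K => [|d IH] I K sI sK fK cm.
  have [Kq qmin] := cm; rewrite /= (ideal_colon sI).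
  split=> [|Q IQ Qq]; first exact: filtered_prime fK (@subset_refl _ _) Kq.
  apply: qmin => // a /(filtered_colon fK)[s qs /IQ /primeM[Qs|//]].
  by case: qs; apply: Qq.
have [x [qx rx _]] := cm.
have nsI : ~ socle_at (M := A^o) q I.
  by move=> /(filtered_socle fK); apply: regular_socle rx.
have [z [qz rz _]] := common_regular nA nA sI sI nsI nsI.
exists z; split=> //; have sz := submod_mul A^o z.
have [_ [<-] cmz] := CM_at_quotient nA nM sK cm qz (filtered_regular fK rz).
apply: IH cmz; [exact: submod_add|exact: submod_add (submod_mul M z)|].
exact: filtered_mul.
Qed.

(** The kernel of [z] is finitely generated, so a single [f] kills it. *)
Lemma regular_at_open p K z : submodule K -> regular_at p K z ->
  exists2 f, ~ spec_set p f & forall q, ~ spec_set q f -> regular_at q K z.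
Proof.
move=> sK rz; pose L : set M := [set x | K (z *: x)].
have sL : submodule L.
  split; first by rewrite /L /= scaler0; apply: submod0.
  move=> a x y Lx Ly; rewrite /L /= scalerDr scalerA mulrC -scalerA.
  exact: sK.2.
have [|f pf fL] := @sat_uniform _ _ p K L nM sK sL.
  by move=> x Lx; apply: rz; apply: sat_sub.
exists f => // q qf x [s qs]; rewrite scalerA mulrC -scalerA => /fL Kx.
by exists (f * s); [exact: nprimeM|rewrite -scalerA].
Qed.

(** Cutting by a regular sequence changes neither side of the equivalence and
    makes [p] minimal in the support; there, after shrinking, [M / K] is filtered
    by copies of [A / p]. This applies to the ring itself, so [A / p] serves to
    compare any two modules that are Cohen-Macaulay at [p]. *)
Lemma CM_at_residue p K d : submodule K -> CM_at p K d ->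
  exists2 f, ~ spec_set p f &
    forall q, spec_set p `<=` q -> ~ spec_set q f ->
      (exists e, CM_at q K e) <-> (exists e, CM_at (M := A^o) q p e).
Proof.
elim: d K => [|d IH] K sK.
  move=> /(minimal_filtered nA nM sK)[f pf fP]; exists f => // q pq qf.
  have [n fK] := fP q pq qf; have sp := submod_prime p.
  split=> -[e cm]; exists e; first exact: (CM_filtered sp sK fK cm).
  exact: (filtered_CM sp sK fK cm).
move=> [z [pz rz cmz]]; have sKz := submod_add sK (submod_mul M z).
have [f pf fP] := IH _ sKz cmz; have [g pg gP] := regular_at_open sK rz.
exists (f * g); first exact: nprimeM.
move=> q pq qfg; rewrite -fP //; last by move=> qf; apply/qfg/prime_mulr.
have {}rz : regular_at q K z by apply: gP => qg; apply/qfg/prime_mull.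
split=> -[e cm]; last by exists e.+1, z; split=> //; apply: pq.
have [e' _ cm'] := CM_at_quotient nA nM sK cm (pq z pz) rz.
by exists e'.
Qed.

End Transfer.

(** A minimal prime [Q] of the intersection [I] of all primes outside [U] is not
    in [U]: near a point [Q] of [U] the closure of [Q] avoids the complement of
    [U], while the other minimal primes of [I] can be kept away from [Q], which
    would produce an element of [I] outside [Q]. *)
Theorem nagata_open (A : comNzRingType) (U : set (Spec A)) :
  noetherian_module A^o ->
  (forall p q : Spec A, spec_set q `<=` p -> U p -> U q) ->
  (forall p : Spec A, U p -> exists2 f, ~ spec_set p f &
     forall q : Spec A, spec_set p `<=` q -> ~ spec_set q f -> U q) ->
  open U.
Proof.
move=> nA Ugen Unear.
pose I : set A := [set a | forall q, ~ U q -> spec_set q a].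
have sI : submodule (M := A^o) I.
  split=> [q _|a x y Ix Iy q nUq]; first exact: prime0.
  by apply: primeD; [apply: prime_mull; apply: Ix|apply: Iy].
exists I; apply/seteqP; split=> p /= Up; last first.
  by apply: contrapT => nUp; apply: Up => a; apply.
move=> Ip; have [Q Qp [IQ Qmin]] := minimal_prime_below nA sI Ip.
have [f Qf fU] := Unear Q (Ugen _ _ Qp Up).
have [Ps [IPs PsI]] := minimal_prime_list nA sI.
have [g [Qg gP]] := separate Ps Q.
apply: (nprimeM Qf Qg); apply: IQ => q nUq; apply: contrapT => qfg.
have qg : ~ spec_set q g by move=> qg; apply/qfg/prime_mull.
have qf : ~ spec_set q f by move=> qf; apply/qfg/prime_mulr.
have [P PPs Pq] : exists2 P, P \in Ps & spec_set P `<=` q.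
  by apply: PsI => a; apply.
have [/Pq//|PQ] := gP P PPs.
by apply: nUq; apply: fU => //; rewrite -(Qmin P) //; apply: IPs.
Qed.

(** * Comparison with the localized module *)

Section SmulSeq.
Variables (R : comNzRingType) (N : lmodType R).

Lemma smul_seq_nil : smul_seq (N := N) [::] = [set 0].
Proof.
apply/seteqP; split=> [_ [y ->]|_ ->]; first by rewrite big_ord0.
by exists (fun=> 0); rewrite big_ord0.
Qed.

Lemma smul_seq_rcons (s : seq R) (a : R) :
  smul_seq (N := N) (rcons s a) = addm (smul_seq (N := N) s) (mulm a).
Proof.
apply/seteqP; split=> [_ [y ->]|_ [_ [_ [[y ->] [w ->] ->]]]].
  rewrite size_rcons big_ord_recr /= nth_rcons ltnn eqxx.
  exists (\sum_(i < size s) s`_i *: y i), (a *: y (size s)).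
  split; [by exists y|by exists (y (size s))|].
  by congr (_ + _); apply: eq_bigr => i _; rewrite nth_rcons ltn_ord.
exists (fun i => if (i < size s)%N then y i else w).
rewrite size_rcons big_ord_recr /= nth_rcons !ltnn eqxx.
by congr (_ + _); apply: eq_bigr => i _; rewrite nth_rcons ltn_ord.
Qed.

Lemma chain_height (J : set R) n (P : Spec R) :
  (exists c : nat -> Spec R, [/\ prime_chain n c, forall i, (i <= n)%N -> J `<=` c i
     & c n = P]) <-> height_ge J n P.
Proof.
elim: n P => [|n IH] P /=.
  split=> [[c [_ Jc <-]]|JP]; first exact: Jc.
  by exists (fun=> P).
split=> [[c [chc Jc <-]]|[Q [QP nQP /IH[c [chc Jc cn]]]]].
  exists (c n); have [cS nc] := chc n (ltnSn n); split=> //.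
    by move=> E; apply: nc; rewrite E.
  apply/IH; exists c; split=> // i ilt; [exact/chc/ltnW|exact/Jc/leqW].
exists (fun i => if (i <= n)%N then c i else P); split.
- move=> i; rewrite [in X in X -> _]ltnS [in X in X -> _]leq_eqVlt.
  case/orP=> [/eqP ->|ilt].
    by rewrite /= leqnn ltnn cn; split=> // PQ; apply/nQP/spec_antisym.
  by rewrite /= (ltnW ilt) ilt; apply: chc.
- move=> i /=; case: (leqP i n) => [iln _|_ _]; [exact: Jc|apply: subset_trans QP].
  by rewrite -cn; apply: Jc.
- by rewrite /= ltnn.
Qed.

End SmulSeq.

Section Localized.
Variables (A : comNzRingType) (p : Spec A).
Implicit Types (a b : A) (s t : denom p) (Q : Spec A) (P : Spec (loc_ring p)).

Let frac a s : loc_ring p := loc_frac (a : A^o) s.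

Lemma fracM a b s t : frac a s * frac b t = frac (a * b) (denomM s t).
Proof. exact: loc_mulE. Qed.

Lemma fracD a b s t :
  frac a s + frac b t = frac (sval t * a + sval s * b) (denomM s t).
Proof. exact: (@loc_fracD _ _ A^o). Qed.

Lemma frac_eq a b s t : sval t * a = sval s * b -> frac a s = frac b t.
Proof. exact: (@loc_frac_eq _ _ A^o). Qed.

Lemma frac_ind (T : loc_ring p -> Prop) : (forall a s, T (frac a s)) -> forall z, T z.
Proof. exact: (@loc_ind _ _ A^o). Qed.

Lemma denom_nmem s : ~ spec_set p (sval s).
Proof. by move=> /mem_set; apply/negP/(svalP s). Qed.

Lemma denom_of a : ~ spec_set p a -> exists s, sval s = a.
Proof.
move=> pa; have pa' : a \notin spec_set p by apply/negP => /set_mem.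
by exists (exist (fun b : A => b \notin spec_set p) a pa').
Qed.

Lemma frac_num a s : frac a s = frac 1 s * frac a (denom1 p).
Proof. by rewrite fracM; apply: frac_eq => /=; ring. Qed.

Lemma num_frac a s : frac a (denom1 p) = frac (sval s) (denom1 p) * frac a s.
Proof. by rewrite fracM; apply: frac_eq => /=; ring. Qed.

(** [P] is the extension of [Q]; equivalently [Q] is the contraction of [P]. *)
Definition lies_over P Q : Prop :=
  forall a s, spec_set P (frac a s) <-> spec_set Q a.

Lemma contraction P : exists Q, lies_over P Q.
Proof.
pose I : set A := [set a | spec_set P (frac a (denom1 p))].
have Is a s : spec_set P (frac a s) <-> I a.
  split; first by rewrite /I /= (num_frac a s); apply: prime_mull.
  by rewrite (frac_num a s); apply: prime_mull.
have [||a b|Q QI] := @prime_build A I.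
- split=> [|a b c Ib Ic].
    rewrite /I /=; have -> : frac 0 (denom1 p) = 0 by apply: (@loc_frac0 _ _ A^o).
    exact: prime0.
  have : spec_set P (frac a (denom1 p) * frac b (denom1 p) + frac c (denom1 p)).
    by apply: primeD => //; apply: prime_mull.
  by rewrite fracM fracD /= !mul1r => /Is.
- by rewrite /I /=; apply: prime1.
- by rewrite /I /= => /(Is _ (denomM (denom1 p) (denom1 p))); rewrite -fracM => /primeM.
by exists Q => a s; rewrite QI.
Qed.

Lemma extension Q : spec_set Q `<=` p -> exists P, lies_over P Q.
Proof.
move=> Qp; pose J : set (loc_ring p) :=
  [set z | exists2 a, spec_set Q a & exists s, z = frac a s].
have JE a s : J (frac a s) <-> spec_set Q a.
  split=> [[b Qb [t /(@loc_fracP _ _ A^o)[u E]]]|Qa]; last by exists a => //; exists s.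
  have : spec_set Q ((sval u * sval t) * a) by rewrite [_ * a]E; apply: prime_mull.
  by move=> /primeM[/primeM[]/Qp/denom_nmem|].
have [||z w|P PJ] := @prime_build (loc_ring p) J.
- split; first by exists 0; [exact: prime0|exists (denom1 p); rewrite /frac loc_frac0].
  elim/frac_ind=> c s; elim/frac_ind=> a t; elim/frac_ind=> b u /JE Qa /JE Qb.
  rewrite [_ *: _]fracM [_ + _]fracD; apply/JE.
  by apply: primeD; do ?apply: prime_mull.
- by move/JE/prime1.
- elim/frac_ind: z => a s; elim/frac_ind: w => b t; rewrite fracM => /JE/primeM[] h.
    by left; apply/JE.
  by right; apply/JE.
by exists P => a s; rewrite PJ.
Qed.

Lemma lies_over_sub P Q : lies_over P Q -> spec_set Q `<=` p.
Proof.
move=> PQ a Qa; apply: contrapT => /denom_of[s sE].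
apply: (@prime1 _ P); have -> : 1 = frac a s by apply: frac_eq; rewrite sE /=; ring.
exact/PQ.
Qed.

Lemma lies_over_le P P' Q Q' : lies_over P Q -> lies_over P' Q' ->
  spec_set P `<=` P' <-> spec_set Q `<=` Q'.
Proof.
move=> PQ PQ'; split=> le; last by elim/frac_ind=> a s /PQ/le/PQ'.
by move=> a Qa; apply/(PQ' a (denom1 p))/le/PQ.
Qed.

Lemma lies_over_inj P P' Q : lies_over P Q -> lies_over P' Q -> P = P'.
Proof.
by move=> PQ PQ'; apply: spec_antisym; apply/(lies_over_le _ _); eauto.
Qed.

(** [Q] ranges over the primes inside [p] as [P] ranges over the spectrum of the
    localization, so chains correspond. *)
Lemma lies_over_height (I : set A) (J : set (loc_ring p)) n P Q :
  (forall P Q, lies_over P Q -> J `<=` P <-> I `<=` Q) -> lies_over P Q ->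
  height_ge J n P <-> height_ge I n Q.
Proof.
move=> JI; elim: n P Q => [|n IH] P Q PQ; first exact: JI.
split=> [[P' [P'P nP'P hP']]|[Q' [Q'Q nQ'Q hQ']]].
  have [Q' PQ'] := contraction P'; exists Q'; split.
  - exact/(lies_over_le PQ' PQ).
  - by move=> E; apply: nP'P; rewrite E in PQ'; apply: lies_over_inj PQ' PQ.
  - exact/(IH _ _ PQ').
have [P' PQ'] := extension (subset_trans Q'Q (lies_over_sub PQ)).
exists P'; split.
- exact/(lies_over_le PQ' PQ).
- move=> E; apply: nQ'Q; rewrite E in PQ'.
  by apply: spec_antisym => a; [move/(PQ' a (denom1 p))/PQ|move/(PQ a (denom1 p))/PQ'].
- exact/(IH _ _ PQ').
Qed.

Section LocalizedModule.
Variable M : lmodType A.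
Hypotheses (nA : noetherian_module A^o) (nM : noetherian_module M).
Implicit Types (K : set M) (x y : M).

Let K0 : set M := [set 0].

Lemma loc_scale_frac a x s t :
  frac a s *: loc_frac x t = loc_frac (a *: x) (denomM s t).
Proof. exact: loc_scaleE. Qed.

Lemma loc_frac_eq0 x s : loc_frac x s = 0 <-> sat p K0 x.
Proof.
rewrite -(loc_frac0 M s) -loc_fracP; split=> [[u E]|[u pu Ku]].
  exists (sval u * sval s); last by rewrite /K0 /= E scaler0.
  by apply: nprimeM; apply: denom_nmem.
have [v vE] := denom_of pu; exists v.
by rewrite scaler0 vE mulrC -scalerA [u *: x]Ku scaler0.
Qed.

Lemma loc_mod_zero : (forall z : loc_mod p M, z = 0) <-> ~ colon K0 `<=` p.
Proof.
rewrite (colon_supp p nM (submod_0 M)); split=> [all [x nx]|nex].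
  by apply/nx/(loc_frac_eq0 x (denom1 p)).
elim/loc_ind=> x s; apply/loc_frac_eq0; apply: contrapT => nx.
by apply: nex; exists x.
Qed.

Lemma annihilator_lies_over P Q : lies_over P Q ->
  annihilator (loc_mod p M) `<=` P <-> colon K0 `<=` Q.
Proof.
move=> PQ; split=> le.
  move=> a Ka; apply/(PQ a (denom1 p))/le; elim/loc_ind=> x t.
  by rewrite loc_scale_frac [a *: x](Ka x) loc_frac0.
elim/frac_ind=> a s ann; apply/PQ; have Qp := lies_over_sub PQ.
have [||t pt aL] := @sat_uniform _ _ p K0 (mulm a) nM (submod_0 M).
- exact: submod_mul.
- move=> _ [x ->]; apply/(loc_frac_eq0 _ (denomM s (denom1 p))).
  by rewrite -loc_scale_frac; apply: ann.
have : colon K0 (t * a) by move=> x; rewrite -scalerA; apply: aL; exists x.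
by move=> /le /primeM[/Qp //|].
Qed.

Definition cut K (s : seq A) : set M := foldl (fun L z => addm L (mulm z)) K s.

Lemma submod_cut K (s : seq A) : submodule K -> submodule (cut K s).
Proof.
by elim: s K => //= z s IH K sK; apply: IH; apply: submod_add => //; apply: submod_mul.
Qed.

Lemma regular_seq_atP K (s : seq A) : regular_seq_at p K s <->
  [/\ forall i, (i < size s)%N -> spec_set p s`_i,
      forall i, (i < size s)%N -> regular_at p (cut K (take i s)) s`_i
    & colon (cut K s) `<=` p].
Proof.
elim: s K => [|z s IH] K /=; first by split=> [?|[]].
split=> [[pz rz /IH[ps rs sp]]|[ps rs sp]].
  by split=> // -[|i] //=; [apply: ps|apply: rs].
split; [exact: (ps 0%N)|by have := rs 0%N isT; rewrite /cut /=|].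
by apply/IH; split=> // i; [apply: (ps i.+1)|apply: (rs i.+1)].
Qed.

Let fr (l : A * denom p) : loc_ring p := frac l.1 l.2.

Lemma smul_seq_frac (l : seq (A * denom p)) x t :
  smul_seq (N := loc_mod p M) (map fr l) (loc_frac x t) <->
  sat p (cut K0 (map fst l)) x.
Proof.
elim/last_ind: l x t => [|l [a s] IH] x t.
  by rewrite smul_seq_nil; apply: loc_frac_eq0.
rewrite !map_rcons smul_seq_rcons /cut foldl_rcons -/(cut _ _) /=.
set K := cut _ _ in IH *; have sK : submodule K by apply: submod_cut (submod_0 M).
have sa := submod_mul M a; have sKa := submod_add sK sa.
split.
  move=> [w [_ [Sw [y ->]]]]; elim/loc_ind: w Sw => w w2 /IH Kw.
  elim/loc_ind: y => y v; rewrite loc_scale_frac loc_fracD => /loc_fracP[u /= E].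
  have pE : ~ spec_set p (sval u * (sval w2 * (sval s * sval v))).
    by do !apply: nprimeM; apply: denom_nmem.
  apply: (satZ pE); rewrite E scalerDr; have sS := submod_sat p sKa.
  apply: submodD => //; apply: submodZ => //.
    by apply: (satS (subset_addl sa)); apply: submodZ => //; apply: submod_sat.
  apply: sat_sub; apply: subset_addr => //; exists (sval w2 *: y).
  by rewrite !scalerA mulrC.
move=> [r pr [k [_ [Kk [y ->] E]]]]; have [u uE] := denom_of pr.
exists (loc_frac k (denomM u t)), (frac a s *: loc_frac (sval s *: y) (denomM u t)).
split; [exact/IH/sat_sub|by exists (loc_frac (sval s *: y) (denomM u t))|].
rewrite loc_scale_frac loc_fracD; apply: loc_frac_eq => /=.
have -> : sval u * sval t * (sval s * (sval u * sval t)) =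
          (sval u * sval t * sval s * sval t) * r by rewrite -uE; ring.
rewrite -scalerA E !scalerDr !scalerA; congr (_ *: _ + _ *: _); ring.
Qed.

Lemma regular_seq_frac (l : seq (A * denom p)) :
  (forall z, z \in map fr l -> loc_max z) /\
    regular_seq (loc_mod p M) (map fr l) <->
  regular_seq_at p K0 (map fst l).
Proof.
rewrite regular_seq_atP !size_map.
have nthE i : (i < size l)%N -> exists a s,
    [/\ (a, s) \in l, (map fr l)`_i = frac a s & (map fst l)`_i = a].
  move=> il; pose d := (0 : A, denom1 p); exists (nth d l i).1, (nth d l i).2.
  by rewrite -surjective_pairing mem_nth // !(nth_map d).
split=> [[lp [rs nT]]|[lp rs nT]].
  split=> [i il|i il|].
  - have [a [s [asl _ ->]]] := nthE i il.
    apply/set_mem/(@loc_maxP _ _ a s)/lp; apply/mapP; by exists (a, s).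
  - move=> x; have [a [s [_ fE ->]]] := nthE i il.
    have := rs i; rewrite size_map => /(_ il (loc_frac x (denom1 p))).
    by rewrite fE loc_scale_frac -!map_take !smul_seq_frac.
  - apply/(colon_supp p nM (submod_cut _ (submod_0 M))).
    apply: contrapT => /forallNP all; apply: nT; apply/seteqP; split=> //.
    by elim/loc_ind=> x t _; apply/smul_seq_frac; apply: contrapT.
split.
  move=> _ /mapP[[a s] asl ->]; apply/loc_maxP/mem_set.
  have iI : (index (a, s) l < size l)%N by rewrite index_mem.
  have := lp _ iI; rewrite (nth_map (0, denom1 p)) //.
  by rewrite nth_index.
split=> [i|E].
  rewrite size_map => il; elim/loc_ind=> x t.
  have [a [s [_ fE aE]]] := nthE i il.
  rewrite fE loc_scale_frac -map_take !smul_seq_frac.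
  by have := rs i il x; rewrite aE -map_take.
have [x nx] := (colon_supp p nM (submod_cut _ (submod_0 M))).1 nT.
by apply/nx/(smul_seq_frac l x (denom1 p)); rewrite E.
Qed.

Lemma is_depthE d : is_depth (loc_mod p M) (loc_max (p := p)) d <->
  is_max (fun n => exists2 s, size s = n & regular_seq_at p K0 s) d.
Proof.
suff E n : (exists s : seq (loc_ring p), [/\ size s = n,
      (forall z, z \in s -> loc_max z) & regular_seq (loc_mod p M) s]) <->
    (exists2 s, size s = n & regular_seq_at p K0 s).
  by split=> -[/E ? mx]; split=> // n /E/mx.
split=> [[s [<- sm rs]]|[s <- rs]].
  pose l := [seq ((repr z).1 : A, (repr z).2) | z <- s].
  have ls : map fr l = s.
    rewrite -map_comp -[RHS]map_id; apply: eq_map => z /=.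
    by rewrite [RHS](@loc_fracE _ _ A^o).
  by exists (map fst l); [rewrite !size_map|apply/regular_seq_frac; rewrite ls].
pose l := [seq (a, denom1 p) | a <- s].
have ls : map fst l = s by rewrite -map_comp map_id.
exists (map fr l); rewrite -ls in rs *; split; first by rewrite !size_map.
  by have [] := (regular_seq_frac l).2 rs.
by have [] := (regular_seq_frac l).2 rs.
Qed.

Lemma is_dimE d : is_dim (loc_mod p M) d <->
  is_max (fun n => height_ge (colon K0) n p) d.
Proof.
suff E n : (exists c : nat -> Spec (loc_ring p), prime_chain n c /\
      forall i, (i <= n)%N -> annihilator (loc_mod p M) `<=` c i) <->
    height_ge (colon K0) n p.
  by split=> -[/E ? mx]; split=> // n /E/mx.
have [P Pp] := extension (@subset_refl _ p).
rewrite -(lies_over_height n annihilator_lies_over Pp).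
split=> [[c [chc annc]]|/chain_height[c [chc annc _]]]; last by exists c.
have : height_ge (annihilator (loc_mod p M)) n (c n) by apply/chain_height; exists c.
have cP : spec_set (c n) `<=` P.
  have [Q cQ] := contraction (c n).
  by apply/(lies_over_le cQ Pp); apply: lies_over_sub cQ.
have [->//|ncP h] := pselect (c n = P).
by apply: height_geW; exists (c n).
Qed.

(** If the depth equals the dimension [d], then a regular sequence of length [d]
    leaves no room for a chain of primes; conversely a regular sequence of
    length [d] produces a chain of length [d], and Krull's theorem bounds all
    chains by [d]. *)
Theorem cohen_macaulay_locE :
  cohen_macaulay (loc_mod p M) (loc_max (p := p)) <->
  ~ colon K0 `<=` p \/ exists d, CM_at p K0 d.
Proof.
have s0 := submod_0 M; rewrite /cohen_macaulay loc_mod_zero.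
split=> -[nK|[d h]]; [by left|right|by left|right; exists d].
  move: h => [/is_depthE[[s sd rs] _] /is_dimE[_ hmax]].
  by exists (size s); apply: regular_seq_CM_at => // n /hmax; rewrite sd.
have [s sd rs] := CM_at_regular_seq h.
rewrite is_depthE is_dimE; split; split.
- by exists s.
- by move=> n [s' <- /(regular_seq_height nA nM s0)]; apply: CM_at_height h.
- by rewrite -sd; apply: regular_seq_height.
- by move=> n; apply: CM_at_height h.
Qed.

End LocalizedModule.

End Localized.

(** * The Cohen-Macaulay locus *)

Section Locus.
Variables (A : comNzRingType) (M : lmodType A).
Hypotheses (nA : noetherian_module A^o) (nM : noetherian_module M).
Implicit Types p q : Spec A.

Lemma CM_locusE p : CM_locus M p <->
  ~ colon [set (0 : M)] `<=` p \/ exists d, CM_at p [set (0 : M)] d.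
Proof. exact: cohen_macaulay_locE. Qed.

Lemma CM_locus_generalize p q :
  spec_set q `<=` p -> CM_locus M p -> CM_locus M q.
Proof.
move=> qp /CM_locusE cm; apply/CM_locusE.
have [Kq|] := pselect (colon [set (0 : M)] `<=` q); last by left.
case: cm => [Kp|[d cm]]; first by left=> _; apply/Kp/(subset_trans Kq).
by right; apply: (CM_at_generalize nA nM (submod_0 M) cm qp Kq).
Qed.

End Locus.

Lemma non_CM_ring_locusE (A : comNzRingType) (p : Spec A) :
  noetherian_module A^o ->
  non_CM_ring_locus A p <-> ~ exists d, CM_at p [set (0 : A^o)] d.
Proof.
move=> nA; have E := CM_locusE nA nA p.
rewrite -[non_CM_ring_locus A p]/(~ CM_locus A^o p) E; split=> [nE|nE [Kp|]//].
  by move=> h; apply: nE; right.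
apply: Kp; rewrite ideal_colon; last exact: submod_0.
by move=> _ ->; apply: prime0.
Qed.

Theorem corollary3p14 (A : comNzRingType) (m : set A)
    (A_noetherian : noetherian A) (A_local : local_ring m)
    (A_catenary : catenary A)
    (A_nonCM_finite : finite_set (non_CM_ring_locus A))
    (M : lmodType A) (M_finite : finite_module M) :
  open (CM_locus M).
Proof.
have nA := noetherian_ideal A_noetherian.
have nM := finite_noetherian A_noetherian M_finite.
have /finite_seqP[Zs ZsE] := A_nonCM_finite.
have nZ q : q \notin Zs -> exists d, CM_at q [set (0 : A^o)] d.
  move=> qZ; apply: contrapT => /(non_CM_ring_locusE q nA).2.
  by rewrite ZsE /=; apply/negP.
apply: nagata_open => // [|p Up]; first exact: CM_locus_generalize.
have [Kp|[d cmp]] := (CM_locusE nA nM p).1 Up.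
  have [a /not_implyP[Ka pa]] : exists a, ~ (colon [set (0 : M)] a -> spec_set p a).
    exact/existsNP.
  exists a => // q _ qa; apply/(CM_locusE nA nM q); left=> Kq.
  exact/qa/Kq.
(* Among the bad primes of the ring, only those inside [p] remain where [g] does
   not vanish. *)
have [g [pg gZ]] := separate Zs p.
have [pZ|pZ] := boolP (p \in Zs).
  (* The closure of [p] consists of bad primes, so [p] is isolated in it. *)
  exists g => // q pq qg; suff -> : q = p by [].
  have qZ : q \in Zs.
    apply: contraLR pZ => /nZ[e cmq].
    have [|e' cmp'] := CM_at_generalize nA nA (submod_0 A^o) cmq pq.
      by rewrite ideal_colon; [move=> _ ->; apply: prime0|exact: submod_0].
    apply/negP => pZ; have : non_CM_ring_locus A p by rewrite ZsE.
    by move/(non_CM_ring_locusE p nA); apply; exists e'.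
  by have [//|qp] := gZ q qZ; apply: spec_antisym.
have [e cmA] := nZ p pZ.
have [f pf fM] := CM_at_residue nA nM (submod_0 M) cmp.
have [h ph hA] := CM_at_residue nA nA (submod_0 A^o) cmA.
exists (f * (g * h)); first by do 2?apply: nprimeM.
move=> q pq qfgh.
have qf : ~ spec_set q f by move=> qf; apply/qfgh/prime_mulr.
have qg : ~ spec_set q g by move=> qg; apply/qfgh/prime_mull/prime_mulr.
have qh : ~ spec_set q h by move=> qh; apply/qfgh/prime_mull/prime_mull.
apply/(CM_locusE nA nM q); right; apply/(fM q pq qf)/(hA q pq qh)/nZ.
by apply: contra pZ => qZ; have [//|qp] := gZ q qZ; rewrite (spec_antisym pq qp).
Qed.
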